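(* In the constrained MDP setting described in the context, suppose the Slater condition and the uniform ergodicity assumption (both stated in the context) hold. Then for every accuracy $\epsilon>0$ (small) the inputs of the algorithm AR-CPO can be chosen so that it outputs an $\epsilon$-optimal policy $\tilde\pi$, i.e. $$V_0^*(\rho)-V_0^{\tilde\pi}(\rho)\le\epsilon\qquad\text{and}\qquad\|(c-V^{\tilde\pi}(\rho))_+\|_1\le\epsilon,$$ with a total computational complexity (total number of queries of the MDP oracle made by all calls of RegPO) of $$\tilde{\mathcal O}\Big(\frac{1}{(1-\gamma)^{3.5}\,\epsilon}\Big).$$
   Context: **Constrained MDP.** $\mathcal S$ and $\mathcal A$ are finite state and action spaces, $\mathsf P(\cdot|s,a)$ is a transition kernel, $\gamma\in(0,1)$ a discount factor, $\rho$ the distribution of the initial state $s_0$, $r_0,\dots,r_m:\mathcal S\times\mathcal A\to\mathbb R$ positive finite reward functions, $c=(c_1,\dots,c_m)^\top\in\mathbb R^m$ thresholds. $r_{i,\max}:=\max_{s,a}r_i(s,a)$ and $R_{\max}:=\sqrt{\sum_{i=1}^m r_{i,\max}^2}$. $\Pi$ is the set of stationary policies $\pi(\cdot|s)$. With $a_t\sim\pi(\cdot|s_t)$, $s_{t+1}\sim\mathsf P(\cdot|s_t,a_t)$, set $V_i^\pi(s):=\mathbb E[\sum_{t\ge0}\gamma^tr_i(s_t,a_t)\mid s_0=s]$, $V_i^\pi(\rho):=\mathbb E_{s_0\sim\rho}[V_i^\pi(s_0)]$, $V^\pi(\rho):=(V_1^\pi(\rho),\dots,V_m^\pi(\rho))^\top$.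 The problem is $\max_{\pi\in\Pi}V_0^\pi(\rho)$ subject to $V_i^\pi(\rho)\ge c_i$, $i=1,\dots,m$; its optimal value is $V_0^*(\rho)$. The discounted visitation distribution is $\nu_\rho^\pi(s,a):=(1-\gamma)\sum_{t\ge0}\gamma^t\Pr\{s_t=s,a_t=a\mid s_0\sim\rho,\pi\}$ and $\chi_\rho^\pi(s):=\sum_{a}\nu_\rho^\pi(s,a)$. $(\cdot)_+$ is the entrywise positive part. **Regularized Lagrangian.** $\mathcal L(\pi,\lambda):=V_0^\pi(\rho)+\langle\lambda,V^\pi(\rho)-c\rangle$; $\mathcal H(\pi):=-\mathbb E[\sum_{t\ge0}\gamma^t\log\pi(a_t|s_t)\mid s_0\sim\rho,\pi]$; $\mathcal L_{\tau,\mu}(\pi,\lambda):=\mathcal L(\pi,\lambda)+\tau\mathcal H(\pi)+\frac\mu2\|\lambda\|_2^2$; $d_{\tau,\mu}(\lambda):=\max_{\pi\in\Pi}\mathcal L_{\tau,\mu}(\pi,\lambda)$. $\pi^*_{\tau,\lambda}$ denotes the solution of $\max_{\pi\in\Pi}\mathcal L_{\tau,\mu}(\pi,\lambda)$, i.e. the optimal policy of the $\tau$-entropy-regularized MDP with reward $r_\lambda:=r_0+\sum_{i=1}^m\lambda_ir_i$; it is the softmax policy $\pi^*_{\tau,\lambda}(a|s)\propto\exp(Q^*_{\tau,\lambda}(s,a)/\tau)$, where $Q^*_{\tau,\lambda}$ is the optimal entropy-regularized Q-function, the unique fixed point of the soft Bellman operator $(\mathcal T_{\tau,\lambda}Q)(s,a)=r_\lambda(s,a)+\gamma\mathbb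 E_{s'\sim\mathsf P(\cdot|s,a)}[\tau\log\sum_{a'}\exp(Q(s',a')/\tau)]$. **Slater condition.** There exist $\xi>0$ and a policy $\pi_\xi\in\Pi$ with $V_i^{\pi_\xi}(\rho)\ge c_i+\xi$ for all $i=1,\dots,m$. Put $B:=\frac{r_{0,\max}}{(1-\gamma)\xi}$. **Uniform ergodicity.** Let $\Lambda:=\{\lambda\in\mathbb R^m_+:\lambda_i\le2B,\ i=1,\dots,m\}$. There are constants $C_M>0$, $0<\beta<1$ such that for every $\lambda\in\Lambda$ and $t\ge0$, $\sup_{s\in\mathcal S}d_{TV}(\mathbb P(s_t\in\cdot\mid s_0=s),\chi_{\pi^*_{\tau,\lambda}})\le C_M\beta^t$, where the chain is induced by $\pi^*_{\tau,\lambda}$ and $\mathsf P$, $\chi_{\pi^*_{\tau,\lambda}}$ is its stationary distribution, and $d_{TV}$ is total variation distance. **Algorithm AR-CPO.** Inputs: $T$, $\eta,\alpha,q,\tau,\mu$, accuracy $\delta$, projection radius $B$. Set $\lambda_0=\bar\lambda_0=0$. For $t=1,\dots,T$: $\underline\lambda_t=(1-q)\bar\lambda_{t-1}+q\lambda_{t-1}$; $\pi_t=\mathrm{RegPO}(\delta,\underline\lambda_t,\tau)$; $\widehat\nabla d_{\tau,\mu}(\underline\lambda_t)=V^{\pi_t}(\rho)-c+\mu\underline\lambda_t$; $\lambda_t=\operatorname{argmin}_{\lambda\in\Lambda}\{\eta[\langle\widehat\nabla d_{\tau,\mu}(\underline\lambda_t),\lambda\rangle+\frac\mu2\|\lambda-\underline\lambda_t\|_2^2]+\frac12\|\lambda-\lambda_{t-1}\|_2^2\}$;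 $\bar\lambda_t=(1-\alpha)\bar\lambda_{t-1}+\alpha\lambda_t$. Output $$\tilde\pi(a|s)=\frac{(1-\alpha)^{T-1}\nu_\rho^{\pi_1}(s,a)+\sum_{t=2}^T\alpha(1-\alpha)^{T-t}\nu_\rho^{\pi_t}(s,a)}{(1-\alpha)^{T-1}\chi_\rho^{\pi_1}(s)+\sum_{t=2}^T\alpha(1-\alpha)^{T-t}\chi_\rho^{\pi_t}(s)}$$ (an arbitrary distribution over actions at states where the denominator vanishes). **RegPO and complexity.** $\mathrm{RegPO}(\delta,\lambda,\tau)$ returns a policy $\pi$ with $\|\pi-\pi^*_{\tau,\lambda}\|_\infty\le\delta$. It has access to an exact MDP oracle giving the expected value of an update; the paper uses either natural policy gradient with exact gradients, or soft Q-learning, which iterates $Q_{k+1}=\mathcal T_{\tau,\lambda}(Q_k)$ from $Q_0=0$ and returns $\pi_K(a|s)\propto\exp(Q_K(s,a)/\tau)$, one oracle query per iteration. A call uses $K=\big\lceil\log\big(\frac{2(r_{0,\max}+BR_{\max})}{(1-\gamma)\delta\tau}\big)/\log(1/\gamma)\big\rceil$ iterations (up to an additive constant). $f=\tilde{\mathcal O}(g)$ means $f\le a\,g\log^n(g)$ for some constants $a>0$, $n\in\mathbb N$; here the constants do not depend on $\epsilon$ and $\gamma$ (they may depend on $m$, $|\mathcal A|$, the rewards' maxima, $\xi$, $C_M$, $\beta$). *)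

(* Defs.v *)
From mathcomp Require Import all_boot all_order all_algebra.
From mathcomp Require Import all_classical all_reals all_analysis.
Import Order.TTheory GRing.Theory Num.Theory.
Import numFieldNormedType.Exports.

Set Implicit Arguments.
Unset Strict Implicit.
Unset Printing Implicit Defensive.

Local Open Scope classical_set_scope.
Local Open Scope ring_scope.

Definition is_dist (R : realType) (X : finType) (p : X -> R) : Prop :=
  (forall x, 0 <= p x) /\ \sum_(x : X) p x = 1.

Definition unit_mass (R : realType) (X : finType) (x : X) : X -> R :=
  fun y => (y == x)%:R.

(** Total variation distance: the largest discrepancy over all events. *)
Definition dTV (R : realType) (X : finType) (p p' : X -> R) : R :=
  \big[Num.max/0]_(E : {set X}) `|\sum_(x in E) p x - \sum_(x in E) p' x|.

Definition dotv (R : realType) (m : nat) (x y : 'rV[R]_m) : R :=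
  \sum_(i < m) x 0 i * y 0 i.

(** Squared Euclidean norm (the library norm on matrices is the sup norm). *)
Definition sqnorm2 (R : realType) (m : nat) (x : 'rV[R]_m) : R := dotv x x.

(** A constrained MDP with [m] constraints.  [reward ord0] is the objective
    reward and [reward (lift ord0 i)], for [i : 'I_m], the reward of the
    constraint whose threshold is [threshold 0 i]. *)
Record cmdp (R : realType) (S A : finType) (m : nat) := CMDP {
  kernel : S -> A -> S -> R;
  discount : R;
  init : S -> R;
  reward : 'I_m.+1 -> S -> A -> R;
  threshold : 'rV[R]_m;
  kernel_dist : forall s a, is_dist (kernel s a);
  discount_itv : 0 < discount < 1;
  init_dist : is_dist init;
  reward_gt0 : forall i s a, 0 < reward i s a
}.

Definition is_policy (R : realType) (S A : finType) (pi : S -> A -> R) : Prop :=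
  forall s, is_dist (pi s).

Section CMDP.
Context {R : realType} {S A : finType} {m : nat} (M : cmdp R S A m).
Implicit Types (pi : S -> A -> R) (lam : 'rV[R]_m) (Q f : S -> A -> R).

Local Notation P := (kernel M).
Local Notation gamma := (discount M).
Local Notation rho := (init M).

(** Probability that [(s_0, a_0), (s_1, a_1), ...] starts with the finite
    trajectory [w], when [s_0] has law [mu] and actions follow [pi]. *)
Fixpoint traj_prob pi (mu : S -> R) (w : seq (S * A)) : R :=
  match w with
  | [::] => 1
  | (s, a) :: w' => mu s * pi s a * traj_prob pi (P s a) w'
  end.

(** Pr(s_t = s, a_t = a | s_0 ~ mu, pi) *)
Definition prob_at pi (mu : S -> R) (t : nat) (s : S) (a : A) : R :=
  \sum_(w : t.+1.-tuple (S * A) | tnth w ord_max == (s, a)) traj_prob pi mu w.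

(** Pr(s_t = s | s_0 ~ mu, pi) *)
Definition state_prob pi (mu : S -> R) (t : nat) (s : S) : R :=
  \sum_(w : t.+1.-tuple (S * A) | (tnth w ord_max).1 == s) traj_prob pi mu w.

(** Expected discounted sum of [f s_t a_t] over the first [n] steps. *)
Definition trunc_value pi f (s0 : S) (n : nat) : R :=
  \sum_(w : n.-tuple (S * A)) traj_prob pi (unit_mass R s0) w *
    (\sum_(t < n) gamma ^+ t * f (tnth w t).1 (tnth w t).2).

(** E[sum_t gamma^t f(s_t, a_t) | s_0]; [f] is bounded, so the infinite sum is
    the limit of its truncations. *)
Definition svalue pi f (s0 : S) : R := limn (trunc_value pi f s0).

Definition value pi f : R := \sum_(s : S) rho s * svalue pi f s.

Definition V0 pi : R := value pi (reward M ord0).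

Definition Vc pi : 'rV[R]_m := \row_(i < m) value pi (reward M (lift ord0 i)).

Definition feasible pi : Prop :=
  is_policy pi /\ forall i, threshold M 0 i <= Vc pi 0 i.

Definition V0_opt : R := sup [set V0 pi | pi in [set pi | feasible pi]].

Definition visitation pi (s : S) (a : A) : R :=
  (1 - gamma) * limn (series (fun t => gamma ^+ t * prob_at pi rho t s a)).

Definition state_visitation pi (s : S) : R := \sum_(a : A) visitation pi s a.

(** Rewards are positive, so the default value 0 does not interfere. *)
Definition reward_max (i : 'I_m.+1) : R :=
  \big[Num.max/0]_(x : S * A) reward M i x.1 x.2.

Definition Rmax : R := Num.sqrt (\sum_(i < m) reward_max (lift ord0 i) ^+ 2).

Definition lagrangian pi lam : R := V0 pi + dotv lam (Vc pi - threshold M).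

(** [ln 0 = 0] in the library, and such actions have probability 0. *)
Definition entropy pi : R := - value pi (fun s a => ln (pi s a)).

Definition reward_lam lam : S -> A -> R :=
  fun s a => reward M ord0 s a + \sum_(i < m) lam 0 i * reward M (lift ord0 i) s a.

Definition soft_bellman (tau : R) lam Q : S -> A -> R := fun s a =>
  reward_lam lam s a +
  gamma * \sum_(s' : S) P s a s' * (tau * ln (\sum_(a' : A) expR (Q s' a' / tau))).

Definition softmax (tau : R) Q : S -> A -> R :=
  fun s a => expR (Q s a / tau) / \sum_(a' : A) expR (Q s a' / tau).

(** The maximizer of [L(pi, lam) + tau H(pi)]; the term [mu/2 |lam|^2] of the
    regularized Lagrangian does not depend on [pi].  Maximization alone leaves
    the policy undetermined at states that are not reachable from [init]: the
    maximizer meant is the softmax of the fixed point of the soft Bellman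
    operator. *)
Definition opt_policy (tau : R) lam : S -> A -> R :=
  xget (fun _ _ => 0) [set pi | [/\ is_policy pi,
    forall pi', is_policy pi' ->
      lagrangian pi' lam + tau * entropy pi' <= lagrangian pi lam + tau * entropy pi &
    exists Q, soft_bellman tau lam Q = Q /\ pi = softmax tau Q]].

Definition slater (xi : R) : Prop :=
  exists2 pi, is_policy pi & forall i, threshold M 0 i + xi <= Vc pi 0 i.

Definition radius (xi : R) : R := reward_max ord0 / ((1 - gamma) * xi).

Definition Lam (xi : R) : set 'rV[R]_m :=
  [set lam | forall i, 0 <= lam 0 i <= 2 * radius xi].

Definition stationary pi (chi : S -> R) : Prop :=
  is_dist chi /\
  forall s', chi s' = \sum_(s : S) \sum_(a : A) chi s * pi s a * P s a s'.

(** The constants are uniform in the regularization parameter [tau], which is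
    an input of the algorithm. *)
Definition uniformly_ergodic (xi CM beta : R) : Prop :=
  forall tau, 0 < tau -> forall lam, Lam xi lam ->
  exists2 chi, stationary (opt_policy tau lam) chi &
    forall t s,
      dTV (state_prob (opt_policy tau lam) (unit_mass R s) t) chi <= CM * beta ^+ t.

Record arcpo_input := ArcpoInput {
  horizon : nat; eta : R; alpha : R; q : R; tau : R; mu : R; delta : R
}.

Definition valid_input (inp : arcpo_input) : Prop :=
  [/\ (0 < horizon inp)%N, 0 < eta inp, 0 < alpha inp <= 1 & 0 <= q inp <= 1] /\
  [/\ 0 < tau inp, 0 < mu inp & 0 < delta inp].

(** [regpo delta lam tau] is the policy returned by a call of RegPO, and
    [queries delta lam tau] the number of oracle queries the call makes. *)
Section Algorithm.
Context (regpo : R -> 'rV[R]_m -> R -> S -> A -> R)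
        (queries : R -> 'rV[R]_m -> R -> nat).
Context (xi : R) (inp : arcpo_input).

Definition mix (l lbar : 'rV[R]_m) : 'rV[R]_m :=
  (1 - q inp) *: lbar + q inp *: l.

Definition grad_est (u : 'rV[R]_m) : 'rV[R]_m :=
  Vc (regpo (delta inp) u (tau inp)) - threshold M + mu inp *: u.

Definition prox_obj (u l l' : 'rV[R]_m) : R :=
  eta inp * (dotv (grad_est u) l' + mu inp / 2 * sqnorm2 (l' - u)) +
  2^-1 * sqnorm2 (l' - l).

Definition prox_step (u l : 'rV[R]_m) : 'rV[R]_m :=
  xget 0 [set l' | Lam xi l' /\
                   forall l'', Lam xi l'' -> prox_obj u l l' <= prox_obj u l l''].

(** The pair of the iterate and of the averaged iterate after [t] steps. *)
Fixpoint arcpo_state (t : nat) : 'rV[R]_m * 'rV[R]_m :=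
  if t is t'.+1 then
    let: (l, lbar) := arcpo_state t' in
    let l' := prox_step (mix l lbar) l in
    (l', (1 - alpha inp) *: lbar + alpha inp *: l')
  else (0, 0).

(** The point at which step [t] (for [1 <= t]) calls RegPO. *)
Definition query_point (t : nat) : 'rV[R]_m :=
  mix (arcpo_state t.-1).1 (arcpo_state t.-1).2.

Definition arcpo_policy (t : nat) : S -> A -> R :=
  regpo (delta inp) (query_point t) (tau inp).

Definition out_num (s : S) (a : A) : R :=
  (1 - alpha inp) ^+ (horizon inp).-1 * visitation (arcpo_policy 1) s a +
  \sum_(2 <= t < (horizon inp).+1)
    alpha inp * (1 - alpha inp) ^+ (horizon inp - t) * visitation (arcpo_policy t) s a.

Definition out_den (s : S) : R :=
  (1 - alpha inp) ^+ (horizon inp).-1 * state_visitation (arcpo_policy 1) s +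
  \sum_(2 <= t < (horizon inp).+1)
    alpha inp * (1 - alpha inp) ^+ (horizon inp - t) * state_visitation (arcpo_policy t) s.

Definition arcpo_output (pit : S -> A -> R) : Prop :=
  is_policy pit /\
  forall s, out_den s != 0 -> forall a, pit s a = out_num s a / out_den s.

Definition total_queries : nat :=
  \sum_(1 <= t < (horizon inp).+1) queries (delta inp) (query_point t) (tau inp).

(** RegPO returns a policy within [delta], in the entrywise sup norm. *)
Definition regpo_accurate : Prop :=
  forall lam, Lam xi lam ->
    is_policy (regpo (delta inp) lam (tau inp)) /\
    forall s a,
      `|regpo (delta inp) lam (tau inp) s a - opt_policy (tau inp) lam s a| <= delta inp.

Definition regpo_iterations : int :=
  Num.ceil (ln (2 * (reward_max ord0 + radius xi * Rmax) /
                ((1 - gamma) * delta inp * tau inp)) / ln gamma^-1).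

Definition regpo_cost (k0 : nat) : Prop :=
  forall lam, Lam xi lam ->
    ((queries (delta inp) lam (tau inp))%:Z <= regpo_iterations + k0%:Z)%R.

End Algorithm.

(** Soft Q-learning, [N] iterations from [Q = 0], one query per iteration. *)
Definition soft_qlearning (N : nat) (delta : R) lam (tau : R) : S -> A -> R :=
  softmax tau (iter N (soft_bellman tau lam) (fun _ _ => 0)).

Definition eps_optimal (eps : R) pi : Prop :=
  V0_opt - V0 pi <= eps /\
  \sum_(i < m) Num.max (threshold M 0 i - Vc pi 0 i) 0 <= eps.

End CMDP.

(* Main.v *)
(** With x = sqrt (1 - gamma), entropy regularization [tau ~ eps x^2] costs an
    error of order eps.  Each evaluation [pi |-> V^pi] is Lipschitz with constant
    O(x^-4), the softmax policy is Lipschitz in the soft Q-function with constant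
    O(1 / tau), and the soft Q-function is Lipschitz in lambda with constant
    O(x^-2); hence the dual function has gradient Lipschitz constant
    O(1 / (eps x^8)).  Only a regularization [mu ~ eps x^2] is needed, because the
    quadratic term is charged against the violation multiplied by B ~ x^-2.
    Accelerated proximal descent then contracts at rate [alpha ~ eps x^5].  Its
    potential dominates the dual optimum by the same convex combination of the
    Lagrangians [pi |-> L(pi, lambda)], for every lambda in Lambda, as the one that
    defines the output; since occupancy measures are convex, this is the Lagrangian
    of the output policy.  Taking lambda = 0 bounds the optimality gap, and
    lambda = 2B on the violated constraints bounds the violation, because by the
    Slater condition the objective can exceed its optimum by at most B times the
    violation.  There are O(log / (eps x^5)) steps of O(log / x^2) queries. *)
Require Import Defs.
From mathcomp Require Import all_boot all_order all_algebra.
From mathcomp Require Import all_classical all_reals all_analysis.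
From mathcomp Require Import ring lra.
Import Order.TTheory GRing.Theory Num.Theory.
Import numFieldNormedType.Exports.
Local Open Scope ring_scope.
Set Implicit Arguments.
Unset Strict Implicit.
Unset Printing Implicit Defensive.

(** * Trajectory sums and discounted occupancy measures *)

Lemma big_tuple_cons (R : realType) (T : finType) n (F : n.+1.-tuple T -> R) :
  \sum_w F w = \sum_x \sum_(w : n.-tuple T) F [tuple of x :: w].
Proof.
rewrite pair_big (reindex (fun p : T * n.-tuple T => [tuple of p.1 :: p.2])) //=.
exists (fun w : n.+1.-tuple T => (thead w, [tuple of behead w])) => [[x w]|w] _ /=.
  by congr pair; apply: val_inj.
by rewrite -tuple_eta.
Qed.

Lemma big_tuple0 (R : realType) (T : finType) (F : 0.-tuple T -> R) :
  \sum_w F w = F [tuple].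
Proof. by rewrite (big_pred1 [tuple]) // => w; apply/esym/eqP; exact: tuple0. Qed.

Lemma cvg_fin_sum (R : realType) (I : finType) (u : I -> nat -> R) (l : I -> R) :
  (forall i, u i @ \oo --> l i)%classic ->
  ((fun n => \sum_i u i n) @ \oo --> \sum_i l i)%classic.
Proof.
by move=> ul; apply: cvg_big => [|i _]; [exact: add_continuous|exact: ul].
Qed.

Section Occupancy.
Context (R : realType) (S A : finType) (m : nat) (M : cmdp R S A m).
Implicit Types (mu : S -> R) (f : S -> A -> R).

Local Notation P := (Defs.kernel M).
Local Notation gamma := (discount M).
Local Notation rho := (init M).

Lemma gamma_gt0 : 0 < gamma. Proof. by case/andP: (discount_itv M). Qed.
Lemma gamma_ge0 : 0 <= gamma. Proof. exact/ltW/gamma_gt0. Qed.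
Lemma gamma_lt1 : gamma < 1. Proof. by case/andP: (discount_itv M). Qed.
Lemma ogamma_gt0 : 0 < 1 - gamma. Proof. by rewrite subr_gt0 gamma_lt1. Qed.

Lemma ogamma_ge0 : 0 <= 1 - gamma. Proof. exact/ltW/ogamma_gt0. Qed.

(** State laws evolve linearly under this map, so sums over trajectories reduce to its iterates. *)
Definition push (pi : S -> A -> R) mu : S -> R :=
  fun s' => \sum_(x : S * A) mu x.1 * pi x.1 x.2 * P x.1 x.2 s'.

Lemma pushE pi mu s' :
  push pi mu s' = \sum_(x : S * A) mu x.1 * pi x.1 x.2 * P x.1 x.2 s'.
Proof. by []. Qed.

Lemma iter_push_sum pi (I : finType) (c : I -> R) (nu : I -> S -> R) t s :
  iter t (push pi) (fun s' => \sum_i c i * nu i s') s =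
  \sum_i c i * iter t (push pi) (nu i) s.
Proof.
elim: t s => [//|t IH] s; rewrite iterS pushE.
under eq_bigr do rewrite IH mulr_suml mulr_suml.
rewrite exchange_big; apply: eq_bigr => i _ /=.
by rewrite pushE mulr_sumr; apply: eq_bigr => x _; rewrite !mulrA.
Qed.

(** Trajectories recurse on their first step, iterates of [push] on their last one; linearity
    reconciles the two. *)
Lemma iter_push_shift pi mu t s :
  \sum_(x : S * A) mu x.1 * pi x.1 x.2 * iter t (push pi) (P x.1 x.2) s =
  iter t.+1 (push pi) mu s.
Proof. by rewrite iterSr -iter_push_sum. Qed.

Lemma prob_at0 pi mu s a : prob_at M pi mu 0 s a = mu s * pi s a.
Proof.
rewrite /prob_at big_mkcond big_tuple_cons (bigD1 (s, a)) //= [X in _ + X]big1 => [|x xsa].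
  by rewrite addr0 big_tuple0 (tnth_nth (s, a)) /= eqxx mulr1.
by rewrite big_tuple0 (tnth_nth (s, a)) /= (negbTE xsa).
Qed.

Lemma prob_atS pi mu t s a : prob_at M pi mu t.+1 s a =
  \sum_(x : S * A) mu x.1 * pi x.1 x.2 * prob_at M pi (P x.1 x.2) t s a.
Proof.
rewrite /prob_at big_mkcond big_tuple_cons; apply: eq_bigr => -[s0 a0] _ /=.
rewrite mulr_sumr [RHS]big_mkcond; apply: eq_bigr => w _.
by rewrite !(tnth_nth (s0, a0)) /=.
Qed.

Lemma prob_atE pi mu t s a : prob_at M pi mu t s a = iter t (push pi) mu s * pi s a.
Proof.
elim: t mu => [|t IH] mu; first exact: prob_at0.
rewrite prob_atS -iter_push_shift mulr_suml; apply: eq_bigr => x _.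
by rewrite IH mulrA.
Qed.

Section Policy.
Variables (pi : S -> A -> R) (hpi : is_policy pi).

Lemma policy_ge0 s a : 0 <= pi s a. Proof. by case: (hpi s). Qed.
Lemma policy_sum1 s : \sum_a pi s a = 1. Proof. by case: (hpi s). Qed.
Lemma kernel_ge0 s a s' : 0 <= P s a s'. Proof. by case: (kernel_dist M s a). Qed.
Lemma kernel_sum1 s a : \sum_s' P s a s' = 1. Proof. by case: (kernel_dist M s a). Qed.

Lemma sum_policy mu : \sum_(x : S * A) mu x.1 * pi x.1 x.2 = \sum_s mu s.
Proof.
rewrite -(pair_big predT predT (fun s a => mu s * pi s a)) /=.
by apply: eq_bigr => s _; rewrite -mulr_sumr policy_sum1 mulr1.
Qed.

Lemma push_dist mu : is_dist mu -> is_dist (push pi mu).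
Proof.
move=> [mu0 mu1]; split.
  by move=> s; apply: sumr_ge0 => x _; rewrite !mulr_ge0 ?policy_ge0 ?kernel_ge0.
rewrite /push exchange_big /=.
under eq_bigr do rewrite -mulr_sumr kernel_sum1 mulr1.
by rewrite sum_policy.
Qed.

Lemma iter_push_dist mu t : is_dist mu -> is_dist (iter t (push pi) mu).
Proof. by move=> hmu; elim: t => //= t; exact: push_dist. Qed.

Lemma dist_le1 (X : finType) (p : X -> R) x : is_dist p -> p x <= 1.
Proof. by move=> [p0 <-]; rewrite (bigD1 x) //= lerDl sumr_ge0. Qed.

Definition occ_series mu s : nat -> R :=
  series (fun t => gamma ^+ t * iter t (push pi) mu s).

Definition occ mu s : R := limn (occ_series mu s).

Lemma occ_cvg mu s : is_dist mu -> (occ_series mu s @ \oo --> occ mu s)%classic.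
Proof.
move=> hmu; apply: (@series_le_cvg _ _ (fun t => gamma ^+ t)) => [t|t|t|].
- by rewrite mulr_ge0 ?exprn_ge0 ?gamma_ge0 //; case: (iter_push_dist t hmu).
- by rewrite exprn_ge0 ?gamma_ge0.
- by rewrite ler_piMr ?exprn_ge0 ?gamma_ge0 // dist_le1 //; exact: iter_push_dist.
- have -> : (fun t => gamma ^+ t) = geometric 1 gamma.
    by apply/funext => t; rewrite /= mul1r.
  by apply: is_cvg_geometric_series; rewrite ger0_norm ?gamma_ge0 ?gamma_lt1.
Qed.

Lemma occ_ge0 mu s : is_dist mu -> 0 <= occ mu s.
Proof.
move=> hmu; apply: limr_ge; first by apply: cvgP; exact: occ_cvg.
apply: nearW => n; apply: sumr_ge0 => t _.
by rewrite mulr_ge0 ?exprn_ge0 ?gamma_ge0 //; case: (iter_push_dist t hmu).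
Qed.

(** Shifting the partial sums by one keeps their limit, and the shifted sum is the initial law plus
    [gamma] times one transition of the unshifted sum. *)
Lemma occ_flow mu s' : is_dist mu ->
  occ mu s' = mu s' + gamma * \sum_(x : S * A) occ mu x.1 * pi x.1 x.2 * P x.1 x.2 s'.
Proof.
move=> hmu; have h := @occ_cvg mu s' hmu; rewrite -cvg_shiftS in h.
apply: (cvg_unique _ h) => //.
have -> : [sequence occ_series mu s' n.+1]_n = fun n => mu s' +
   gamma * \sum_(x : S * A) occ_series mu x.1 n * pi x.1 x.2 * P x.1 x.2 s'.
  apply/funext => n; rewrite /occ_series /series /= big_nat_recl //= expr0 mul1r.
  congr (_ + _); under [in RHS]eq_bigr do rewrite !mulr_suml.
  rewrite exchange_big mulr_sumr; apply: eq_bigr => t _ /=.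
  rewrite pushE !mulr_sumr; apply: eq_bigr => x _.
  by rewrite exprS !mulrA.
apply: cvgD; first exact: cvg_cst.
apply: cvgMl_tmp.
apply: (@cvg_fin_sum _ _ (fun x n => occ_series mu x.1 n * pi x.1 x.2 * P x.1 x.2 s')) => x.
by do 2!apply: cvgMr_tmp; exact: occ_cvg.
Qed.

Lemma unit_mass_dist (X : finType) (x : X) : is_dist (unit_mass R x).
Proof.
split=> [y|]; first by rewrite /unit_mass ler0n.
by rewrite (bigD1 x) //= /unit_mass eqxx big1 ?addr0 // => y /negbTE ->.
Qed.

Lemma unit_massE mu : mu = fun s' => \sum_s mu s * unit_mass R s s'.
Proof.
apply/funext => s'; rewrite (bigD1 s') //= /unit_mass eqxx mulr1 big1 ?addr0 //.
by move=> s; rewrite eq_sym => /negbTE ->; rewrite mulr0.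
Qed.

Lemma occ_unit mu s : is_dist mu -> occ mu s = \sum_s0 mu s0 * occ (unit_mass R s0) s.
Proof.
move=> hmu; have h := @occ_cvg mu s hmu.
apply: (cvg_unique _ h) => //.
have -> : occ_series mu s = fun n => \sum_s0 mu s0 * occ_series (unit_mass R s0) s n.
  apply/funext => n; rewrite /occ_series /series /=.
  under [in RHS]eq_bigr do rewrite mulr_sumr.
  rewrite exchange_big; apply: eq_bigr => t _ /=.
  rewrite {1}(unit_massE mu) iter_push_sum mulr_sumr.
  by apply: eq_bigr => s0 _; rewrite mulrCA.
apply: (@cvg_fin_sum _ _ (fun s0 n => mu s0 * occ_series (unit_mass R s0) s n)) => s0.
by apply: cvgMl_tmp; apply: occ_cvg; exact: unit_mass_dist.
Qed.

Lemma traj_prob_sum1 mu n : is_dist mu ->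
  \sum_(w : n.-tuple (S * A)) traj_prob M pi mu w = 1.
Proof.
elim: n mu => [|n IH] mu hmu.
  by rewrite big_tuple0.
rewrite big_tuple_cons -[RHS](proj2 hmu) -sum_policy; apply: eq_bigr => -[s a] _ /=.
by rewrite -mulr_sumr IH ?mulr1 //; exact: kernel_dist.
Qed.

(** [trunc_value] from an arbitrary initial law: after one step the law is [P s a], so induction on
    the horizon needs this generality. *)
Definition tval f mu n : R := \sum_(w : n.-tuple (S * A)) traj_prob M pi mu w *
    (\sum_(t < n) gamma ^+ t * f (tnth w t).1 (tnth w t).2).

Lemma tvalE f mu n :
  tval f mu n = \sum_(x : S * A) occ_series mu x.1 n * pi x.1 x.2 * f x.1 x.2.
Proof.
suff -> : tval f mu n = \sum_(t < n) gamma ^+ t *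
    \sum_(x : S * A) iter t (push pi) mu x.1 * pi x.1 x.2 * f x.1 x.2.
  rewrite /occ_series /series /=.
  under [in RHS]eq_bigr do rewrite !mulr_suml.
  rewrite exchange_big /= big_mkord; apply: eq_bigr => t _.
  by rewrite mulr_sumr; apply: eq_bigr => x _; rewrite !mulrA.
elim: n mu => [|n IH] mu.
  by rewrite /tval big_ord0; apply: big1 => w _; rewrite big_ord0 mulr0.
(* Splitting off the first pair: its reward keeps coefficient one because the probabilities of the
   remaining trajectories sum to one. *)
have step (x : S * A) : \sum_(w : n.-tuple (S * A)) traj_prob M pi mu (x :: w) *
    (\sum_(t < n.+1) gamma ^+ t * f (tnth [tuple of x :: w] t).1 (tnth [tuple of x :: w] t).2) =
    mu x.1 * pi x.1 x.2 * f x.1 x.2 + mu x.1 * pi x.1 x.2 * (gamma * tval f (P x.1 x.2) n).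
  case: x => s a /=.
  rewrite -[X in X + _]mulr1 -(traj_prob_sum1 n (kernel_dist M s a)) /tval !mulr_sumr.
  rewrite -big_split; apply: eq_bigr => w _ /=.
  rewrite big_ord_recl /= expr0 mul1r !mulrDr; congr (_ + _); first by ring.
  rewrite !mulr_sumr; apply: eq_bigr => t _.
  by rewrite !(tnth_nth (s, a)) /= exprS; ring.
rewrite [LHS]big_tuple_cons; under eq_bigr do rewrite step IH.
rewrite big_split /= big_ord_recl expr0 mul1r; congr (_ + _).
under eq_bigr do rewrite !mulr_sumr.
rewrite exchange_big; apply: eq_bigr => t _ /=.
under eq_bigr do rewrite !mulr_sumr.
rewrite exchange_big mulr_sumr; apply: eq_bigr => y _ /=.
rewrite -/(iter t.+1 (push pi) mu y.1) -iter_push_shift !mulr_suml mulr_sumr.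
by apply: eq_bigr => x _; rewrite exprS; ring.
Qed.

Lemma svalueE f s0 :
  svalue M pi f s0 = \sum_(x : S * A) occ (unit_mass R s0) x.1 * pi x.1 x.2 * f x.1 x.2.
Proof.
apply/cvg_lim => //.
have -> : trunc_value M pi f s0 = fun n => \sum_(x : S * A)
    occ_series (unit_mass R s0) x.1 n * pi x.1 x.2 * f x.1 x.2.
  by apply/funext => n; rewrite -tvalE.
apply: (@cvg_fin_sum _ _ (fun x n =>
  occ_series (unit_mass R s0) x.1 n * pi x.1 x.2 * f x.1 x.2)) => x.
by do 2!apply: cvgMr_tmp; apply: occ_cvg; exact: unit_mass_dist.
Qed.

Lemma visitationE s a : visitation M pi s a = (1 - gamma) * occ rho s * pi s a.
Proof.
rewrite /visitation -mulrA; congr (_ * _); apply/cvg_lim => //.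
have -> : (fun t => gamma ^+ t * prob_at M pi rho t s a) =
          fun t => gamma ^+ t * iter t (push pi) rho s * pi s a.
  by apply/funext => t; rewrite prob_atE mulrA.
rewrite (_ : series _ = fun n => occ_series rho s n * pi s a); last first.
  by apply/funext => n; rewrite /occ_series /series /= mulr_suml.
by apply: cvgMr_tmp; apply: occ_cvg; exact: init_dist.
Qed.

Lemma state_visitationE s : state_visitation M pi s = (1 - gamma) * occ rho s.
Proof.
rewrite /state_visitation; under eq_bigr do rewrite visitationE.
by rewrite -mulr_sumr policy_sum1 mulr1.
Qed.

Lemma visitation_policy s a : visitation M pi s a = state_visitation M pi s * pi s a.
Proof. by rewrite state_visitationE visitationE. Qed.

Lemma visitation_ge0 s a : 0 <= visitation M pi s a.
Proof.
rewrite visitationE mulr_ge0 ?policy_ge0 // mulr_ge0 ?ogamma_ge0 //.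
by rewrite occ_ge0 //; exact: init_dist.
Qed.

Lemma state_visitation_ge0 s : 0 <= state_visitation M pi s.
Proof. by apply: sumr_ge0 => a _; exact: visitation_ge0. Qed.

Lemma visitation_flow s' : state_visitation M pi s' =
  (1 - gamma) * rho s' + gamma * \sum_(x : S * A) visitation M pi x.1 x.2 * P x.1 x.2 s'.
Proof.
rewrite state_visitationE occ_flow; last exact: init_dist.
rewrite mulrDr; congr (_ + _); rewrite mulrCA; congr (_ * _).
by rewrite mulr_sumr; apply: eq_bigr => x _; rewrite visitationE !mulrA.
Qed.

(** From here on values are linear functionals of the visitation measure, and trajectories disappear
    from the arguments. *)
Lemma value_visitation f :
  (1 - gamma) * value M pi f = \sum_(x : S * A) visitation M pi x.1 x.2 * f x.1 x.2.
Proof.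
rewrite /value; under eq_bigr do rewrite svalueE mulr_sumr.
rewrite exchange_big mulr_sumr; apply: eq_bigr => x _ /=.
rewrite visitationE (occ_unit _ (init_dist M)) mulr_sumr mulr_sumr !mulr_suml.
by apply: eq_bigr => s _; ring.
Qed.

Lemma state_visitation_sum1 : \sum_s state_visitation M pi s = 1.
Proof.
have : \sum_s state_visitation M pi s =
    (1 - gamma) + gamma * \sum_s state_visitation M pi s.
  under [LHS]eq_bigr do rewrite visitation_flow.
  rewrite big_split /= -!mulr_sumr (proj2 (init_dist M)) mulr1; congr (_ + _ * _).
  rewrite exchange_big /=.
  under eq_bigr do rewrite -mulr_sumr kernel_sum1 mulr1 visitation_policy.
  exact: sum_policy.
have := ogamma_gt0; set z := \sum_s _ => u0 hz.
have : (1 - gamma) * (z - 1) = 0 by lra.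
by move/eqP; rewrite mulf_eq0 gt_eqF //= subr_eq0 => /eqP.
Qed.

End Policy.
End Occupancy.

(** * Uniqueness, stability and mixtures of occupancy measures *)

Section OccupancyTheory.
Context (R : realType) (S A : finType) (m : nat) (M : cmdp R S A m).
Implicit Types (pi : S -> A -> R) (f : S -> A -> R).

Local Notation P := (Defs.kernel M).
Local Notation gamma := (discount M).
Local Notation rho := (init M).

(** Stochastic kernels do not expand the l1 norm, which makes the flow equation a
    [gamma]-contraction in that norm. *)
Lemma sum_kernel_le (h : S * A -> R) :
  \sum_s `|\sum_(x : S * A) h x * P x.1 x.2 s| <= \sum_x `|h x|.
Proof.
apply: (@le_trans _ _ (\sum_s \sum_(x : S * A) `|h x| * P x.1 x.2 s)).
  apply: ler_sum => s _; apply: le_trans (ler_norm_sum _ _ _) _.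
  by apply: ler_sum => x _; rewrite normrM (ger0_norm (kernel_ge0 _ _ _ _)).
rewrite exchange_big /=; apply: ler_sum => x _.
by rewrite -mulr_sumr kernel_sum1 mulr1.
Qed.

Lemma contraction_le (z c : R) : z <= gamma * z + c -> z <= c / (1 - gamma).
Proof. by move=> h; rewrite ler_pdivlMr ?ogamma_gt0 //; lra. Qed.

(** The difference of two solutions solves the homogeneous flow equation, so its l1 norm is at most
    [gamma] times itself. *)
Lemma occupancy_unique pi (chi : S -> R) : is_policy pi ->
  (forall s', chi s' = (1 - gamma) * rho s' +
     gamma * \sum_(x : S * A) chi x.1 * pi x.1 x.2 * P x.1 x.2 s') ->
  forall s, chi s = state_visitation M pi s.
Proof.
move=> hpi hchi.
pose d s := chi s - state_visitation M pi s.
have dE s' : d s' = gamma * \sum_(x : S * A) (d x.1 * pi x.1 x.2) * P x.1 x.2 s'.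
  rewrite {1}/d hchi (visitation_flow M hpi) opprD addrACA subrr add0r -mulrBr -sumrB.
  congr (_ * _); apply: eq_bigr => x _.
  by rewrite (visitation_policy M hpi) /d !mulrBl.
have d0 : \sum_s `|d s| <= 0 / (1 - gamma).
  apply: contraction_le; rewrite addr0.
  under [leLHS]eq_bigr do rewrite dE normrM (ger0_norm (gamma_ge0 M)).
  rewrite -mulr_sumr ler_pM2l ?gamma_gt0 //; apply: le_trans (sum_kernel_le _) _.
  under eq_bigr do rewrite normrM (ger0_norm (policy_ge0 hpi _ _)).
  by rewrite (sum_policy hpi (fun s => `|d s|)).
move=> s; apply/eqP; rewrite -subr_eq0 -normr_eq0 -/(d s) eq_le normr_ge0 andbT.
by rewrite mul0r in d0; apply: le_trans d0; rewrite (bigD1 s) //= lerDl sumr_ge0.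
Qed.

(** The difference splits into a change of state occupancy, absorbed by the contraction, and a
    change of action probabilities, which costs at most [#|A| * delta]. *)
Lemma visitation_lipschitz pi pi' (delta : R) : is_policy pi -> is_policy pi' ->
  (forall s a, `|pi s a - pi' s a| <= delta) ->
  \sum_(x : S * A) `|visitation M pi x.1 x.2 - visitation M pi' x.1 x.2|
    <= #|A|%:R * delta / (1 - gamma).
Proof.
move=> hpi hpi' hd; apply: contraction_le.
pose d s := state_visitation M pi s - state_visitation M pi' s.
apply: (@le_trans _ _ (\sum_(x : S * A) (`|d x.1| * pi x.1 x.2 +
    state_visitation M pi' x.1 * delta))).
  apply: ler_sum => -[s a] _ /=; rewrite !visitation_policy //.
  rewrite (_ : _ - _ = d s * pi s a + state_visitation M pi' s * (pi s a - pi' s a)).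
    apply: le_trans (ler_normD _ _) _.
    rewrite !normrM (ger0_norm (policy_ge0 hpi _ _)) lerD2l.
    by rewrite (ger0_norm (state_visitation_ge0 M hpi' s)) ler_wpM2l // state_visitation_ge0.
  by rewrite /d; ring.
rewrite big_split /= lerD //.
  rewrite (sum_policy hpi (fun s => `|d s|)).
  rewrite (eq_bigr (fun s => gamma * `|\sum_(x : S * A)
    (visitation M pi x.1 x.2 - visitation M pi' x.1 x.2) * P x.1 x.2 s|)).
    by rewrite -mulr_sumr ler_pM2l ?gamma_gt0 // sum_kernel_le.
  move=> s _; rewrite /d !visitation_flow // opprD addrACA subrr add0r -mulrBr -sumrB.
  rewrite normrM (ger0_norm (gamma_ge0 M)); congr (_ * `|_|).
  by apply: eq_bigr => x _; rewrite mulrBl.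
rewrite -(pair_big predT predT (fun s (a : A) => state_visitation M pi' s * delta)) /=.
under eq_bigr do rewrite sumr_const -mulr_natl.
by rewrite -mulr_sumr -mulr_suml (state_visitation_sum1 M hpi') mul1r.
Qed.

Lemma valueE pi f : is_policy pi -> value M pi f =
  (\sum_(x : S * A) visitation M pi x.1 x.2 * f x.1 x.2) / (1 - gamma).
Proof.
by move=> hpi; rewrite -value_visitation // mulrC mulKf // gt_eqF ?ogamma_gt0.
Qed.

Lemma value_lipschitz pi pi' f (delta F : R) : is_policy pi -> is_policy pi' ->
  (forall s a, `|pi s a - pi' s a| <= delta) ->
  (forall s a, `|f s a| <= F) -> 0 <= F ->
  `|value M pi f - value M pi' f| <= #|A|%:R * delta * F / (1 - gamma) ^+ 2.
Proof.
move=> hpi hpi' hd hf F0; rewrite !valueE // -mulrBl -sumrB normrM.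
have i0 : 0 <= (1 - gamma)^-1 by rewrite invr_ge0 ogamma_ge0.
rewrite (ger0_norm i0) expr2 invfM mulrA ler_wpM2r //.
apply: le_trans (ler_norm_sum _ _ _) _.
apply: (@le_trans _ _ (\sum_(x : S * A)
    `|visitation M pi x.1 x.2 - visitation M pi' x.1 x.2| * F)).
  by apply: ler_sum => x _; rewrite -mulrBl normrM ler_wpM2l.
by rewrite -mulr_suml [leRHS]mulrAC ler_wpM2r //; exact: visitation_lipschitz.
Qed.

Lemma value_le pi f (F : R) : is_policy pi ->
  (forall s, \sum_a pi s a * f s a <= F) -> value M pi f <= F / (1 - gamma).
Proof.
move=> hpi hf; rewrite valueE // ler_wpM2r ?invr_ge0 ?ogamma_ge0 //.
rewrite -(pair_big predT predT (fun s a => visitation M pi s a * f s a)) /=.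
rewrite -[leRHS]mul1r -(state_visitation_sum1 M hpi) mulr_suml; apply: ler_sum => s _.
under eq_bigr do rewrite visitation_policy // -mulrA.
by rewrite -mulr_sumr ler_wpM2l // state_visitation_ge0.
Qed.

Lemma value_ge0 pi f : is_policy pi -> (forall s a, 0 <= f s a) -> 0 <= value M pi f.
Proof.
move=> hpi hf; rewrite valueE // mulr_ge0 ?invr_ge0 ?ogamma_ge0 //.
by apply: sumr_ge0 => x _; rewrite mulr_ge0 // visitation_ge0.
Qed.

Section Mixture.
Variables (I : finType) (w : I -> R) (pol : I -> S -> A -> R) (pit : S -> A -> R).
Hypotheses (w_ge0 : forall i, 0 <= w i) (w_sum1 : \sum_i w i = 1)
  (hpol : forall i, is_policy (pol i)) (hpit : is_policy pit).
Let den s := \sum_i w i * state_visitation M (pol i) s.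
Hypothesis pitE : forall s a, den s != 0 ->
  pit s a = (\sum_i w i * visitation M (pol i) s a) / den s.

(** The mixed measure satisfies the flow equation of the policy obtained from it by conditioning,
    and that equation has a unique solution. *)
Lemma visitation_mixture s a :
  visitation M pit s a = \sum_i w i * visitation M (pol i) s a.
Proof.
have numE s0 a0 : den s0 * pit s0 a0 = \sum_i w i * visitation M (pol i) s0 a0.
  (* Where the mixed occupancy vanishes [pit] is arbitrary, but each nonnegative summand vanishes as
     well, so both sides are zero. *)
  have [den0|den0] := eqVneq (den s0) 0; last by rewrite pitE // mulrC divfK.
  have t0 i : 0 <= w i * state_visitation M (pol i) s0.
    by rewrite mulr_ge0 ?state_visitation_ge0.
  rewrite den0 mul0r big1 // => i _; rewrite visitation_policy // mulrA.
  by rewrite (psumr_eq0P _ den0) ?mul0r.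
rewrite visitation_policy // -numE; congr (_ * _); apply/esym.
apply: (occupancy_unique hpit) => s'; rewrite /den.
under eq_bigr do rewrite (visitation_flow M) // mulrDr.
rewrite big_split /= -mulr_suml w_sum1 mul1r; congr (_ + _).
under eq_bigr do rewrite mulrCA mulr_sumr.
rewrite -mulr_sumr exchange_big /=; congr (_ * _); apply: eq_bigr => x _.
by rewrite -/(den x.1) numE mulr_suml; apply: eq_bigr => i _; rewrite mulrA.
Qed.

Lemma value_mixture f : value M pit f = \sum_i w i * value M (pol i) f.
Proof.
rewrite valueE //; under [RHS]eq_bigr do rewrite valueE // mulrA.
rewrite -mulr_suml; congr (_ / _).
under [RHS]eq_bigr do rewrite mulr_sumr.
rewrite exchange_big /=; apply: eq_bigr => x _.
by rewrite visitation_mixture mulr_suml; apply: eq_bigr => i _; rewrite mulrA.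
Qed.

End Mixture.

Lemma mixture_policy (I : finType) (w : I -> R) (pol : I -> S -> A -> R) :
  (forall i, 0 <= w i) -> \sum_i w i = 1 -> (forall i, is_policy (pol i)) ->
  exists2 pit, is_policy pit &
    forall f, value M pit f = \sum_i w i * value M (pol i) f.
Proof.
move=> w0 w1 hpol.
(* Weights summing to one force an index to exist; its policy is the fallback at states of zero
   occupancy. *)
have [i0 _] : exists i0 : I, true.
  apply: contrapT => nI; have := oner_neq0 R.
  by rewrite -w1 big1 ?eqxx // => i _; case: nI; exists i.
pose den s := \sum_i w i * state_visitation M (pol i) s.
have den0 s : 0 <= den s.
  by apply: sumr_ge0 => i _; rewrite mulr_ge0 ?state_visitation_ge0.
pose pit s a := if den s == 0 then pol i0 s a
  else (\sum_i w i * visitation M (pol i) s a) / den s.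
have hpit : is_policy pit.
  move=> s; rewrite /pit; case: eqP => [_|/eqP ds]; first exact: hpol.
  split=> [a|].
    by rewrite divr_ge0 //; apply: sumr_ge0 => i _; rewrite mulr_ge0 ?visitation_ge0.
  rewrite -mulr_suml exchange_big /=.
  by under eq_bigr do rewrite -mulr_sumr; rewrite divff.
exists pit => // f; apply: value_mixture => // s a ds.
by rewrite /pit (negbTE ds).
Qed.

End OccupancyTheory.

(** * Soft Bellman operator *)

Section Softmax.
Context (R : realType) (S A : finType) (m : nat) (M : cmdp R S A m).
Implicit Types (Q : S -> A -> R) (lam : 'rV[R]_m).
Hypothesis A_gt0 : (0 < #|A|)%N.
Variable tau : R.
Hypothesis tau_gt0 : 0 < tau.

Local Notation P := (Defs.kernel M).
Local Notation gamma := (discount M).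

Definition partition_fun Q s : R := \sum_(a : A) expR (Q s a / tau).

Lemma partition_fun_gt0 Q s : 0 < partition_fun Q s.
Proof.
have [a _] : exists a : A, true by case/card_gt0P: A_gt0 => a; exists a.
by rewrite /partition_fun (bigD1 a) //= ltr_wpDr ?expR_gt0 // sumr_ge0 // => b _; exact: expR_ge0.
Qed.

Lemma softmax_gt0 Q s a : 0 < softmax tau Q s a.
Proof. by rewrite divr_gt0 ?expR_gt0 ?partition_fun_gt0. Qed.

Lemma softmax_policy Q : is_policy (softmax tau Q).
Proof.
move=> s; split=> [a|]; first exact/ltW/softmax_gt0.
by rewrite -mulr_suml divff // gt_eqF // partition_fun_gt0.
Qed.

Lemma expR_shift_le (x y d : R) : `|x - y| <= d ->
  expR (x / tau) <= expR (d / tau) * expR (y / tau).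
Proof.
move=> h; rewrite -expRD ler_expR -mulrDl ler_wpM2r ?invr_ge0 ?(ltW tau_gt0) //.
by have := ler_norm (x - y); lra.
Qed.

Lemma partition_fun_le Q Q' s (d : R) : (forall a, `|Q s a - Q' s a| <= d) ->
  partition_fun Q s <= expR (d / tau) * partition_fun Q' s.
Proof. by move=> h; rewrite mulr_sumr; apply: ler_sum => a _; exact: expR_shift_le. Qed.

(** Numerator and partition function each change by a factor at most [exp (d / tau)], so
    [p <= exp (2d / tau) * p']; then [1 - y <= exp (- y)] and [p <= 1] linearize this. *)
Lemma softmax_sub_le Q Q' s a (d : R) : (forall b, `|Q s b - Q' s b| <= d) ->
  softmax tau Q s a - softmax tau Q' s a <= 2 * d / tau.
Proof.
move=> h; have h' b : `|Q' s b - Q s b| <= d by rewrite distrC.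
have d0 : 0 <= d by apply: le_trans (h a).
set p := softmax _ Q _ _; set p' := softmax _ Q' _ _.
set E := expR (d / tau).
have pZ : p * partition_fun Q s = expR (Q s a / tau).
  by rewrite /p /softmax divfK // gt_eqF // partition_fun_gt0.
have pZ' : p' * partition_fun Q' s = expR (Q' s a / tau).
  by rewrite /p' /softmax divfK // gt_eqF // partition_fun_gt0.
have p'0 : 0 < p' := softmax_gt0 Q' s a.
have p0 : 0 < p := softmax_gt0 Q s a.
have E0 : 0 < E := expR_gt0 _.
have hp : p <= E ^+ 2 * p'.
  rewrite -(ler_pM2r (partition_fun_gt0 Q s)) pZ.
  apply: le_trans (expR_shift_le (h a)) _; rewrite -/E -pZ' expr2.
  have := ler_wpM2l (ltW (mulr_gt0 E0 p'0)) (partition_fun_le h').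
  by rewrite -/E; lra.
have p1 : p <= 1 by apply: dist_le1; exact: softmax_policy.
have : p * (1 - 2 * d / tau) <= p'.
  apply: (@le_trans _ _ (p * expR (- (2 * d / tau)))).
    by rewrite ler_wpM2l ?(ltW p0) // (le_trans _ (expR_ge1Dx _)).
  rewrite expRN ler_pdivrMr ?expR_gt0 // mulrC.
  by rewrite (_ : 2 * d / tau = d / tau + d / tau) ?expRD -?expr2 //; lra.
have : p * (2 * d / tau) <= 2 * d / tau.
  by rewrite ler_piMl // divr_ge0 ?mulr_ge0 ?(ltW tau_gt0).
lra.
Qed.

Lemma softmax_lipschitz Q Q' (d : R) : (forall s a, `|Q s a - Q' s a| <= d) ->
  forall s a, `|softmax tau Q s a - softmax tau Q' s a| <= 2 * d / tau.
Proof.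
move=> h s a; rewrite ler_norml lerNl opprB !softmax_sub_le // => b.
by rewrite distrC.
Qed.

Lemma reward_le i s a : reward M i s a <= reward_max M i.
Proof. by rewrite /reward_max (le_bigmax 0 (fun x => reward M i x.1 x.2) (s, a)). Qed.

Lemma reward_max_ge0 i : 0 <= reward_max M i.
Proof. by rewrite /reward_max bigmax_ge_id. Qed.

(** Bounds the sup-norm change of [reward_lam] when the multiplier moves by [lam]. *)
Definition wnorm1 lam : R := \sum_(i < m) `|lam 0 i| * reward_max M (lift ord0 i).

(** Log-sum-exp is nonexpansive in the sup norm. Varying the multiplier and the Q-function together
    lets one estimate serve stability of the fixed point, its a priori bound and the convergence of
    the iteration. *)
Lemma soft_bellman_lipschitz lam lam' Q Q' (d : R) :
  (forall s a, `|Q s a - Q' s a| <= d) -> forall s a,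
  `|soft_bellman M tau lam Q s a - soft_bellman M tau lam' Q' s a|
    <= wnorm1 (lam - lam') + gamma * d.
Proof.
move=> h s a; rewrite /soft_bellman opprD addrACA; apply: le_trans (ler_normD _ _) _.
apply: lerD.
  rewrite /reward_lam opprD addrACA subrr add0r -sumrB.
  apply: le_trans (ler_norm_sum _ _ _) _; apply: ler_sum => i _.
  rewrite -mulrBl normrM !mxE ler_wpM2l // ger0_norm ?reward_le //.
  exact/ltW/reward_gt0.
rewrite -mulrBr -sumrB normrM (ger0_norm (gamma_ge0 M)) ler_pM2l ?gamma_gt0 //.
apply: le_trans (ler_norm_sum _ _ _) _.
rewrite -[leRHS]mul1r -(kernel_sum1 M s a) mulr_suml; apply: ler_sum => s' _.
rewrite -mulrBr normrM (ger0_norm (kernel_ge0 _ _ _ _)) ler_wpM2l ?kernel_ge0 //.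
have lse q q' : (forall a, `|q s' a - q' s' a| <= d) ->
    tau * ln (partition_fun q s') - tau * ln (partition_fun q' s') <= d.
  move=> hq; rewrite -mulrBr -ler_pdivlMl // mulrC lerBlDr.
  rewrite -[d / tau]expRK -lnM ?posrE ?expR_gt0 ?partition_fun_gt0 //.
  by rewrite ler_ln ?posrE ?mulr_gt0 ?expR_gt0 ?partition_fun_gt0 // partition_fun_le.
by rewrite ler_norml lerNl opprB !lse // => b; rewrite distrC.
Qed.

(** The hypothesis is applied with [d] the maximum of [h], which is attained on a finite type. *)
Lemma sup_contraction (X : finType) (h : X -> R) (c : R) :
  (forall d, (forall x, h x <= d) -> forall x, h x <= c + gamma * d) ->
  forall x, h x <= c / (1 - gamma).
Proof.
move=> hc x; pose x0 := [arg max_(y > x) h y]%O.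
have h0 y : h y <= h x0 by rewrite /x0; case: arg_maxP => // z _ hz; exact: hz.
by apply: le_trans (h0 x) _; apply: contraction_le; rewrite addrC hc.
Qed.

Lemma soft_fixpoint_lipschitz lam lam' Q Q' :
  soft_bellman M tau lam Q = Q -> soft_bellman M tau lam' Q' = Q' ->
  forall s a, `|Q s a - Q' s a| <= wnorm1 (lam - lam') / (1 - gamma).
Proof.
move=> hQ hQ' s a.
apply: (sup_contraction (h := fun x => `|Q x.1 x.2 - Q' x.1 x.2|) _ (s, a)).
move=> d hd [s' a'] /=; rewrite -{1}hQ -{1}hQ'.
by apply: soft_bellman_lipschitz => s0 a0; exact: (hd (s0, a0)).
Qed.

Lemma wnorm10 : wnorm1 0 = 0.
Proof. by rewrite /wnorm1 big1 // => i _; rewrite mxE normr0 mul0r. Qed.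

Lemma soft_fixpoint_le lam Q : soft_bellman M tau lam Q = Q ->
  forall s a, `|Q s a| <=
    (reward_max M ord0 + wnorm1 lam + tau * #|A|%:R) / (1 - gamma).
Proof.
move=> hQ s a; apply: (sup_contraction (h := fun x => `|Q x.1 x.2|) _ (s, a)).
move=> d hd [s' a'] /=; rewrite -{1}hQ.
have := soft_bellman_lipschitz lam lam (Q := Q) (Q' := fun _ _ => 0) (d := d) _ s' a'.
rewrite subrr wnorm10 add0r => h.
(* Comparison with the operator at [Q = 0], whose value is the reward plus
   [gamma * tau * ln #|A|]. *)
rewrite -[soft_bellman _ _ _ _ _ _](subrK (soft_bellman M tau lam (fun _ _ => 0) s' a')).
apply: le_trans (ler_normD _ _) _; rewrite addrC lerD //; last first.
  by apply: h => s0 a0; rewrite subr0; exact: (hd (s0, a0)).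
rewrite /soft_bellman; apply: le_trans (ler_normD _ _) _; apply: lerD.
  rewrite /reward_lam; apply: le_trans (ler_normD _ _) _; apply: lerD.
    by rewrite ger0_norm ?reward_le // ltW // reward_gt0.
  apply: le_trans (ler_norm_sum _ _ _) _; apply: ler_sum => i _.
  by rewrite normrM ler_wpM2l // ger0_norm ?reward_le // ltW // reward_gt0.
rewrite -mulr_suml kernel_sum1 mul1r mul0r expR0 sumr_const.
have lnA0 : 0 <= ln (#|A|%:R : R) by rewrite ln_ge0 // ler1n.
rewrite ger0_norm ?mulr_ge0 ?gamma_ge0 ?(ltW tau_gt0) //.
apply: le_trans (ler_piMl _ (ltW (gamma_lt1 M))) _; first by rewrite mulr_ge0 ?(ltW tau_gt0).
by rewrite ler_pM2l // ltW // ln_sublinear // ltr0n.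
Qed.

Lemma soft_iteration_le lam Q N (c : R) : soft_bellman M tau lam Q = Q ->
  (forall s a, `|Q s a| <= c) -> forall s a,
  `|iter N (soft_bellman M tau lam) (fun _ _ => 0) s a - Q s a| <= gamma ^+ N * c.
Proof.
move=> hQ hc; elim: N => [|N IH] s a; first by rewrite expr0 mul1r add0r normrN.
rewrite iterS -{1}hQ exprS -mulrA -[leRHS]add0r -{2}wnorm10 -(subrr lam).
exact: soft_bellman_lipschitz.
Qed.

End Softmax.

(** * Dual function *)

Section DualFunction.
Context (R : realType) (S A : finType) (m : nat) (M : cmdp R S A m).
Variables (xi CM beta : R).
Hypotheses (A_gt0 : (0 < #|A|)%N) (ergodic : uniformly_ergodic M xi CM beta).
Implicit Types (l u : 'rV[R]_m).

Local Notation gamma := (discount M).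

Lemma sqr_sum_le (I : finType) (x : I -> R) :
  (\sum_i x i) ^+ 2 <= #|I|%:R * \sum_i x i ^+ 2.
Proof.
apply: (@le_trans _ _ (\sum_i \sum_j 2^-1 * (x i ^+ 2 + x j ^+ 2))).
  rewrite expr2 mulr_suml; apply: ler_sum => i _; rewrite mulr_sumr.
  by apply: ler_sum => j _; have := sqr_ge0 (x i - x j); rewrite sqrrB; lra.
under eq_bigr do rewrite -mulr_sumr big_split /= sumr_const -[x _ ^+ 2 *+ _]mulr_natl.
rewrite -mulr_sumr big_split /= sumr_const -mulr_sumr -[_ *+ _]mulr_natl.
lra.
Qed.

Lemma dotvBr l u u' : dotv l (u - u') = dotv l u - dotv l u'.
Proof. by rewrite /dotv -sumrB; apply: eq_bigr => i _; rewrite !mxE mulrBr. Qed.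

Lemma dotvBl l l' u : dotv (l - l') u = dotv l u - dotv l' u.
Proof. by rewrite /dotv -sumrB; apply: eq_bigr => i _; rewrite !mxE mulrBl. Qed.

Lemma sqnorm2_ge0 l : 0 <= sqnorm2 l.
Proof. by apply: sumr_ge0 => i _; rewrite -expr2 sqr_ge0. Qed.

Variable tau : R.
Hypothesis tau_gt0 : 0 < tau.
Local Notation star := (opt_policy M tau).

(* The junk value [0] of [opt_policy] has no stationary distribution, so ergodicity
   yields the existence of the maximizer. *)
Lemma opt_policyP l : Lam M xi l -> [/\ is_policy (star l),
    forall pi, is_policy pi ->
      lagrangian M pi l + tau * entropy M pi <=
      lagrangian M (star l) l + tau * entropy M (star l) &
    exists Q, soft_bellman M tau l Q = Q /\ star l = softmax tau Q].
Proof.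
move=> hl; have [chi [[_ chi1] hchi] _] := ergodic tau_gt0 hl.
move: hchi; rewrite /opt_policy; case: xgetP => [pi _ //|_ hchi].
exfalso; have := oner_neq0 R; rewrite -chi1 big1 ?eqxx // => s _; rewrite hchi.
by rewrite big1 // => s' _; rewrite big1 // => a _; rewrite mulr0 mul0r.
Qed.

(** Affine in [l], this supports from below, at [u], the dual function without its quadratic term;
    on the diagonal it is that function. *)
Definition dual_cut u l : R := lagrangian M (star u) l + tau * entropy M (star u).

Lemma dual_cut_affine u l l' :
  dual_cut u l - dual_cut u l' = dotv (l - l') (Vc M (star u) - threshold M).
Proof. by rewrite /dual_cut /lagrangian dotvBl; lra. Qed.

Lemma dual_cut_le u l : Lam M xi u -> Lam M xi l -> dual_cut u l <= dual_cut l l.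
Proof. by move=> hu hl; case: (opt_policyP hl) => _ + _; apply; case: (opt_policyP hu). Qed.

Lemma Vc_lipschitz pi pi' (d : R) i : is_policy pi -> is_policy pi' ->
  (forall s a, `|pi s a - pi' s a| <= d) ->
  `|Vc M pi 0 i - Vc M pi' 0 i| <=
     #|A|%:R * d * reward_max M (lift ord0 i) / (1 - gamma) ^+ 2.
Proof.
move=> hpi hpi' hd; rewrite !mxE; apply: value_lipschitz => //.
  by move=> s a; rewrite ger0_norm ?reward_le // ltW // reward_gt0.
exact: reward_max_ge0.
Qed.

Lemma opt_policy_lipschitz u l : Lam M xi u -> Lam M xi l ->
  forall s a, `|star l s a - star u s a| <= 2 * (wnorm1 M (l - u) / (1 - gamma)) / tau.
Proof.
move=> /opt_policyP[_ _ [Qu [fu ->]]] /opt_policyP[_ _ [Ql [fl ->]]].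
apply: (softmax_lipschitz A_gt0 tau_gt0).
exact: (soft_fixpoint_lipschitz A_gt0 tau_gt0).
Qed.

Lemma wnorm1_sqr_le l (r : R) : (forall i, reward_max M (lift ord0 i) <= r) ->
  wnorm1 M l ^+ 2 <= m%:R * r ^+ 2 * sqnorm2 l.
Proof.
move=> hr; apply: le_trans (sqr_sum_le _) _; rewrite card_ord -mulrA ler_wpM2l //.
rewrite mulr_sumr; apply: ler_sum => i _; rewrite -expr2 exprMn real_normK ?num_real //.
rewrite mulrC ler_wpM2r ?sqr_ge0 //.
by rewrite ler_sqr ?nnegrE ?reward_max_ge0 ?(le_trans (reward_max_ge0 M _) (hr i)).
Qed.

(** Optimality at [u] and affinity of the cuts bound the gap by [l - u] paired with the difference
    of two gradients; that difference is Lipschitz because multipliers move the soft Q-function,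
    hence the policy, hence the values. *)
Lemma dual_smooth u l (r : R) : Lam M xi u -> Lam M xi l ->
  (forall i, reward_max M (lift ord0 i) <= r) ->
  dual_cut l l <= dual_cut u l +
    (2 * #|A|%:R * m%:R * r ^+ 2 / (tau * (1 - gamma) ^+ 3)) * sqnorm2 (l - u).
Proof.
move=> hu hl hr.
have [pu _ _] := opt_policyP hu; have [pl _ _] := opt_policyP hl.
pose w := wnorm1 M (l - u).
have h1 := dual_cut_le hl hu.
have h2 := dual_cut_affine l l u; have h3 := dual_cut_affine u l u.
have u0 := ogamma_gt0 M.
pose L := 2 * #|A|%:R / (tau * (1 - gamma) ^+ 3).
have L0 : 0 <= L by rewrite divr_ge0 // mulr_ge0 ?exprn_ge0 ?ogamma_ge0 // ltW.
suff h4 : dotv (l - u) (Vc M (star l) - threshold M) -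
          dotv (l - u) (Vc M (star u) - threshold M) <= L * w ^+ 2.
  apply: (@le_trans _ _ (dual_cut u l + L * w ^+ 2)).
    rewrite -lerBlDl; apply: le_trans h4; rewrite -h2 -h3.
    (* The dropped term [dual_cut u u - dual_cut l u] is nonnegative, as [star u] is optimal at
       [u]. *)
    rewrite [leRHS](_ : _ = dual_cut l l - dual_cut u l + (dual_cut u u - dual_cut l u)).
      by rewrite lerDl subr_ge0.
    by move: (dual_cut l l) (dual_cut u l) (dual_cut l u) (dual_cut u u) => *; ring.
  rewrite lerD2l (_ : 2 * #|A|%:R * m%:R * r ^+ 2 / _ = L * (m%:R * r ^+ 2)).
    by rewrite -[leRHS]mulrA ler_wpM2l // wnorm1_sqr_le.
  by rewrite /L; field; rewrite !gt_eqF.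
rewrite -dotvBr opprB addrA subrK expr2 mulrA {2}/w /wnorm1 mulr_sumr.
apply: ler_sum => i _; apply: le_trans (ler_norm _) _; rewrite normrM.
rewrite [leRHS]mulrCA ler_wpM2l //.
have := Vc_lipschitz i pl pu (opt_policy_lipschitz hu hl).
rewrite [(Vc M (star l) - _) _ _]mxE [(- Vc M (star u)) _ _]mxE => h.
apply: le_trans h _; rewrite le_eqVlt; apply/orP; left; apply/eqP.
by rewrite -/w /L; field; rewrite !gt_eqF.
Qed.

Lemma entropy_ge0 pi : is_policy pi -> 0 <= entropy M pi.
Proof.
move=> hpi; rewrite /entropy oppr_ge0 -(mul0r (1 - gamma)^-1).
apply: value_le => // s; apply: sumr_le0 => a _.
by rewrite mulr_ge0_le0 ?policy_ge0 // ln_le0 // dist_le1.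
Qed.

(** Each action contributes at most one, since [- ln p = ln (1 / p) < 1 / p]; the softmax form
    ensures [p > 0]. *)
Lemma entropy_star_le u : Lam M xi u -> entropy M (star u) <= #|A|%:R / (1 - gamma).
Proof.
move=> /opt_policyP[hpi _ [Q [_ starE]]].
rewrite /entropy lerNl valueE // -mulNr ler_wpM2r ?invr_ge0 ?ogamma_ge0 // lerNl.
rewrite -sumrN -(pair_big predT predT (fun s a =>
  - (visitation M (star u) s a * ln (star u s a)))) /=.
rewrite -[leRHS]mul1r -{1}(state_visitation_sum1 M hpi) mulr_suml; apply: ler_sum => s _.
under eq_bigr do rewrite visitation_policy // -mulrA -mulrN.
rewrite -mulr_sumr ler_wpM2l ?state_visitation_ge0 //.
have -> : #|A|%:R = \sum_(a : A) 1 :> R by rewrite sumr_const.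
apply: ler_sum => a _.
have p0 : 0 < star u s a by rewrite starE softmax_gt0.
rewrite -mulrN -lnV ?posrE // mulrC -ler_pdivlMr // mul1r.
by rewrite ltW // ln_sublinear // invr_gt0.
Qed.

End DualFunction.

(** * Accelerated proximal step *)

Section ProximalStep.
Context (R : realType) (m : nat).
Implicit Types (x y u l g : 'rV[R]_m).

(** The proximal problem separates into coordinates, each solved by clamping the unconstrained
    minimizer [N / c]. Strong convexity of modulus [1 + eta * mu] supplies the extra square. *)
Lemma clamp_prox (eta mu g u l b : R) : 0 < eta -> 0 < mu -> 0 <= b ->
  exists p : R, 0 <= p <= b /\ forall y : R, 0 <= y <= b ->
    eta * (g * p + mu / 2 * ((p - u) * (p - u))) + 2^-1 * ((p - l) * (p - l))
      + (1 + eta * mu) / 2 * ((y - p) * (y - p)) <=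
    eta * (g * y + mu / 2 * ((y - u) * (y - u))) + 2^-1 * ((y - l) * (y - l)).
Proof.
move=> eta0 mu0 b0; pose c := 1 + eta * mu; pose N := eta * mu * u + l - eta * g.
have c0 : 0 < c by rewrite ltr_wpDr // mulr_ge0 ?(ltW eta0) ?(ltW mu0).
(* For a quadratic the claim is the first-order condition at [p], where the derivative is
   [c * p - N]. *)
suff [p hp hy] : exists2 p : R, 0 <= p <= b &
    forall y : R, 0 <= y <= b -> 0 <= (y - p) * (c * p - N).
  by exists p; split=> // y /hy; rewrite /c /N; lra.
have [N0|N0] := leP N 0.
  by exists 0 => [|y /andP[y0 _]]; rewrite ?lexx // subr0 mulr0 sub0r mulr_ge0 ?oppr_ge0.
have [Nb|Nb] := leP N (c * b).
  exists (N / c) => [|y _]; last by rewrite mulrCA divff ?gt_eqF // mulr1 subrr mulr0.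
  by rewrite divr_ge0 ?(ltW N0) ?(ltW c0) //= ler_pdivrMr // mulrC.
exists b => [|y /andP[_ yb]]; first by rewrite b0 lexx.
by rewrite mulr_le0 // subr_le0 // ltW.
Qed.

(** One accelerated step in abstract form: [hc + dotv _ G] is the cut at [u], [e] the gradient
    error, [D] and [D'] dual values at consecutive averages. As [u] and [lb'] share the weight [al],
    [lb' - u = al * (l' - l)], and the proximal term absorbs the smoothness term. *)
Lemma agd_step G e u l lb l' lam (al mu eta ell hc D D' : R) :
  0 < al -> al < 1 -> 0 < mu -> eta = al / ((1 - al) * mu) ->
  ell * al ^+ 2 <= (1 - al) * mu / 2 ->
  let lb' := (1 - al) *: lb + al *: l' in
  let g := G + e + mu *: u in
  u = (1 - al) *: lb + al *: l ->
  D' <= hc + dotv lb' G + ell * sqnorm2 (lb' - u) ->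
  hc + dotv lb G <= D ->
  eta * (dotv g l' + mu / 2 * sqnorm2 (l' - u)) + 2^-1 * sqnorm2 (l' - l)
    + (1 + eta * mu) / 2 * sqnorm2 (lam - l') <=
  eta * (dotv g lam + mu / 2 * sqnorm2 (lam - u)) + 2^-1 * sqnorm2 (lam - l) ->
  D' + mu / 2 * sqnorm2 lb' + mu / 2 * sqnorm2 (lam - l') <=
  (1 - al) * (D + mu / 2 * sqnorm2 lb + mu / 2 * sqnorm2 (lam - l)) +
  al * (hc + dotv lam G + mu / 2 * sqnorm2 lam + dotv e (lam - l')).
Proof.
move=> al0 al1 mu0 etaE hell lb' g uE hD' hD hprox.
pose k := (1 - al) * mu.
have k0 : 0 < k by rewrite mulr_gt0 ?subr_gt0.
(* Multiplied by [k], the proximal inequality carries the weight [al] with which the new cut enters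
   the average. *)
have keta : k * eta = al by rewrite etaE -/k mulrC divfK // gt_eqF.
have {}hprox := ler_wpM2l (ltW k0) hprox.
have key : dotv lb' G + ell * sqnorm2 (lb' - u) + mu / 2 * sqnorm2 lb'
    + mu / 2 * sqnorm2 (lam - l') - (1 - al) * dotv lb G - (1 - al) * (mu / 2) * sqnorm2 lb
    - (1 - al) * (mu / 2) * sqnorm2 (lam - l) - al * dotv lam G
    - al * (mu / 2) * sqnorm2 lam - al * dotv e (lam - l')
    - al * dotv g l' - al * (mu / 2) * sqnorm2 (l' - u) - k / 2 * sqnorm2 (l' - l)
    - (k + al * mu) / 2 * sqnorm2 (lam - l') + al * dotv g lam
    + al * (mu / 2) * sqnorm2 (lam - u) + k / 2 * sqnorm2 (lam - l) <= 0.
  rewrite /sqnorm2 /dotv !mulr_sumr -?sumrN -?big_split -?sumrB /=.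
  rewrite -?sumrN -?big_split -?sumrB /=.
  apply: sumr_le0 => i _; rewrite /lb' /g uE !mxE.
  move: (G 0 i) (e 0 i) (l 0 i) (lb 0 i) (l' 0 i) (lam 0 i) => Gi ei li bi pi yi.
  (* Per coordinate only two squares survive: that of [l' - l], with nonpositive coefficient by the
     condition on [ell], and a negative multiple of that of [lb - l']. *)
  rewrite [leLHS](_ : _ = (ell * al ^+ 2 - (1 - al) * mu / 2) * (pi - li) ^+ 2
     - mu / 2 * al * (1 - al) * (bi - pi) ^+ 2); last by rewrite /k; field.
  rewrite subr_le0; apply: (@le_trans _ _ 0).
    by rewrite mulr_le0_ge0 ?sqr_ge0 // subr_le0.
  rewrite mulr_ge0 ?sqr_ge0 //.
  by rewrite !mulr_ge0 ?subr_ge0 ?invr_ge0 ?ler0n ?(ltW mu0) ?(ltW al0) ?(ltW al1).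
have {}hD := ler_wpM2l (ltW (_ : 0 < 1 - al)) hD; rewrite subr_gt0 in hD; have {}hD := hD al1.
move: hD hD' key hprox keta; rewrite -/k.
move: (dotv lb' G) (sqnorm2 (lb' - u)) (sqnorm2 lb') (sqnorm2 (lam - l')) (dotv lb G)
  (sqnorm2 lb) (sqnorm2 (lam - l)) (dotv lam G) (sqnorm2 lam) (dotv e (lam - l'))
  (dotv g l') (sqnorm2 (l' - u)) (sqnorm2 (l' - l)) (dotv g lam) (sqnorm2 (lam - u)).
move: k0 => _; move: k => k x1 x2 x3 x4 x5 x6 x7 x8 x9 x10 x11 x12 x13 x14 x15.
move=> hD hD' key hprox keta.
have {}hprox : al * (x11 + mu / 2 * x12) + k / 2 * x13 + (k + al * mu) / 2 * x4 <=
    al * (x14 + mu / 2 * x15) + k / 2 * x7.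
  by move: hprox; rewrite -keta; lra.
lra.
Qed.

End ProximalStep.

(** * Convergence of AR-CPO *)

Lemma sqnorm2_eq0 (R : realType) (m : nat) (x : 'rV[R]_m) : sqnorm2 x <= 0 -> x = 0.
Proof.
move=> x0; have {}x0 : sqnorm2 x = 0 by apply/eqP; rewrite eq_le x0 sqnorm2_ge0.
apply/rowP => i; rewrite mxE; apply/eqP; rewrite -sqrf_eq0 expr2.
by rewrite (psumr_eq0P _ x0) // => j _; rewrite -expr2 sqr_ge0.
Qed.

Section Algorithm.
Context (R : realType) (S A : finType) (m : nat) (M : cmdp R S A m).
Variables (xi CM beta : R) (regpo : R -> 'rV[R]_m -> R -> S -> A -> R) (inp : arcpo_input (R := R)).
Hypotheses (A_gt0 : (0 < #|A|)%N) (xi_gt0 : 0 < xi).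
Hypotheses (eta_gt0 : 0 < eta inp) (mu_gt0 : 0 < mu inp).
Implicit Types (l u lam : 'rV[R]_m).

Local Notation gamma := (discount M).
Local Notation B := (Defs.radius M xi).

Lemma radius_ge0 : 0 <= B.
Proof. by rewrite divr_ge0 ?reward_max_ge0 // mulr_ge0 ?ogamma_ge0 // ltW. Qed.

Lemma diam_ge0 : 0 <= 2 * B. Proof. by rewrite mulr_ge0 ?radius_ge0. Qed.

Lemma Lam0 : Lam M xi 0.
Proof. by move=> i; rewrite mxE lexx diam_ge0. Qed.

(** Strong convexity makes the minimizer unique, so the chosen [prox_step] is the coordinatewise
    clamp and inherits its inequality. *)
Lemma prox_stepP u l : Lam M xi (prox_step M regpo xi inp u l) /\
  forall lam, Lam M xi lam ->
    prox_obj M regpo inp u l (prox_step M regpo xi inp u l)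
      + (1 + eta inp * mu inp) / 2 * sqnorm2 (lam - prox_step M regpo xi inp u l)
    <= prox_obj M regpo inp u l lam.
Proof.
pose g := grad_est M regpo inp u; pose obj := prox_obj M regpo inp u l.
have /choice[p hp] := fun i : 'I_m =>
  clamp_prox (g 0 i) (u 0 i) (l 0 i) eta_gt0 mu_gt0 diam_ge0.
pose pv : 'rV[R]_m := \row_i p i.
have pvLam : Lam M xi pv by move=> i; rewrite mxE; case: (hp i).
have pvP lam : Lam M xi lam ->
    obj pv + (1 + eta inp * mu inp) / 2 * sqnorm2 (lam - pv) <= obj lam.
  move=> hlam; rewrite /obj /prox_obj -/g /sqnorm2 /dotv !mulrDr.
  rewrite !mulr_sumr -!big_split /=; apply: ler_sum => i _.
  by have [_ /(_ _ (hlam i))] := hp i; rewrite !mxE !mulrDr.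
have c0 : 0 < (1 + eta inp * mu inp) / 2 by rewrite divr_gt0 // addr_gt0 // mulr_gt0.
set x := prox_step _ _ _ _ _ _.
have [xLam xmin] : Lam M xi x /\ forall y, Lam M xi y -> obj x <= obj y.
  apply: (xgetPex 0 (P := [set y | Lam M xi y /\ forall z, Lam M xi z -> obj y <= obj z]%classic)).
  exists pv; split=> // y /pvP; apply: le_trans.
  by rewrite lerDl mulr_ge0 ?sqnorm2_ge0 ?(ltW c0).
suff -> : x = pv by [].
apply/eqP; rewrite -subr_eq0; apply/eqP; apply: sqnorm2_eq0.
rewrite -(pmulr_rle0 _ c0) -(lerD2l (obj pv)) addr0.
by apply: le_trans (pvP _ xLam) _; exact: xmin.
Qed.

Hypotheses (al_gt0 : 0 < alpha inp) (al_lt1 : alpha inp < 1).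
Hypothesis q_alpha : q inp = alpha inp.

Lemma Lam_mix u l a : 0 <= a <= 1 -> Lam M xi u -> Lam M xi l ->
  Lam M xi ((1 - a) *: u + a *: l).
Proof.
move=> /andP[a0 a1] hu hl i; rewrite !mxE.
have /andP[u0 u1] := hu i; have /andP[l0 l1] := hl i.
rewrite addr_ge0 ?mulr_ge0 ?subr_ge0 //=.
have -> : 2 * B = (1 - a) * (2 * B) + a * (2 * B) by ring.
by rewrite lerD // ler_wpM2l // subr_ge0.
Qed.

Local Notation st := (arcpo_state M regpo xi inp).
Local Notation qp := (query_point M regpo xi inp).

Lemma arcpo_stateS t : st t.+1 = (prox_step M regpo xi inp (qp t.+1) (st t).1,
  (1 - alpha inp) *: (st t).2 + alpha inp *: prox_step M regpo xi inp (qp t.+1) (st t).1).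
Proof. by rewrite /query_point /=; case: (st t). Qed.

Lemma alpha_itv : 0 <= alpha inp <= 1. Proof. by rewrite !ltW. Qed.

Lemma arcpo_state_Lam t : Lam M xi (st t).1 /\ Lam M xi (st t).2.
Proof.
elim: t => [|t [IH1 IH2]]; first by split; exact: Lam0.
rewrite arcpo_stateS /=; have [h _] := prox_stepP (qp t.+1) (st t).1.
by split=> //; apply: Lam_mix => //; exact: alpha_itv.
Qed.

Lemma query_pointE t :
  qp t.+1 = (1 - alpha inp) *: (st t).2 + alpha inp *: (st t).1.
Proof. by rewrite /query_point /mix q_alpha. Qed.

Lemma query_point_Lam t : Lam M xi (qp t.+1).
Proof.
rewrite query_pointE; have [h1 h2] := arcpo_state_Lam t.
by apply: Lam_mix => //; exact: alpha_itv.
Qed.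

Lemma query_point1 : qp 1 = 0.
Proof. by rewrite query_pointE /= !scaler0 addr0. Qed.

Hypotheses (ergodic : uniformly_ergodic M xi CM beta) (tau_gt0 : 0 < tau inp)
  (delta_gt0 : 0 < delta inp) (hslater : slater M xi).
Hypothesis accurate : regpo_accurate M regpo xi inp.
Variable r : R.
Hypothesis hr : forall i, reward_max M (lift ord0 i) <= r.
Hypothesis etaE : eta inp = alpha inp / ((1 - alpha inp) * mu inp).
Let ell := 2 * #|A|%:R * m%:R * r ^+ 2 / (tau inp * (1 - gamma) ^+ 3).
Hypothesis hell : ell * alpha inp ^+ 2 <= (1 - alpha inp) * mu inp / 2.

Local Notation star := (opt_policy M (tau inp)).
Local Notation cut := (dual_cut M (tau inp)).
Local Notation reg u := (regpo (delta inp) u (tau inp)).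

Let rsum := \sum_(i < m) reward_max M (lift ord0 i).
(** Bounds the gradient error paired with a displacement inside [Lam], whose coordinates are at most
    [2 * B]. *)
Definition grad_err : R := 2 * B * (#|A|%:R * delta inp * rsum / (1 - gamma) ^+ 2).

Lemma rsum_ge0 : 0 <= rsum.
Proof. by apply: sumr_ge0 => i _; exact: reward_max_ge0. Qed.

Lemma grad_err_ge0 : 0 <= grad_err.
Proof.
apply: mulr_ge0; first exact: diam_ge0.
by rewrite !mulr_ge0 ?rsum_ge0 ?invr_ge0 ?exprn_ge0 ?ogamma_ge0 ?(ltW delta_gt0).
Qed.

Lemma dotv_grad_err u lam l : Lam M xi u -> (forall i, `|lam 0 i - l 0 i| <= 2 * B) ->
  `|dotv (Vc M (reg u) - Vc M (star u)) (lam - l)| <= grad_err.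
Proof.
move=> hu hd; have [pr ar] := accurate hu.
have [ps _ _] := opt_policyP ergodic tau_gt0 hu.
apply: le_trans (ler_norm_sum _ _ _) _.
rewrite /grad_err /rsum mulr_sumr mulr_suml mulr_sumr; apply: ler_sum => i _.
rewrite normrM mulrC; apply: ler_pM => //; first by rewrite !mxE.
rewrite [(Vc M (reg u) - _) _ _]mxE [(- Vc M (star u)) _ _]mxE.
exact: Vc_lipschitz.
Qed.

Lemma Lam_sub_le lam l : Lam M xi lam -> Lam M xi l ->
  forall i, `|lam 0 i - l 0 i| <= 2 * B.
Proof.
move=> h1 h2 i; have /andP[a0 a1] := h1 i; have /andP[b0 b1] := h2 i.
by rewrite ler_norml; lra.
Qed.

(** Lyapunov function of the accelerated scheme, relative to an arbitrary [lam] and not only to a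
    dual optimum; this freedom later gives both the optimality gap and the violation. *)
Definition potential t lam : R := cut (st t).2 (st t).2
  + mu inp / 2 * sqnorm2 (st t).2 + mu inp / 2 * sqnorm2 (lam - (st t).1).

Definition model u lam : R := cut u lam + mu inp / 2 * sqnorm2 lam.

(** The model at the query point is kept instead of being replaced by a dual value, so that the
    Lagrangians can later be averaged into that of the output. *)
Lemma potential_step t lam : Lam M xi lam ->
  potential t.+1 lam <= (1 - alpha inp) * potential t lam
    + alpha inp * (model (qp t.+1) lam + grad_err).
Proof.
move=> hlam; have [h1 h2] := arcpo_state_Lam t; have hu := query_point_Lam t.
have [hl' hprox] := prox_stepP (qp t.+1) (st t).1.
have [_] := arcpo_state_Lam t.+1; have uE := query_pointE t.
rewrite /potential /model arcpo_stateS /=.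
move: hl' (hprox _ hlam) hu uE.
move: (qp t.+1) (prox_step _ _ _ _ _ _) => u l' hl' {}hprox hu uE.
set lb' := _ + _ => hlb'.
pose G := Vc M (star u) - threshold M; pose e := Vc M (reg u) - Vc M (star u).
have gE : grad_est M regpo inp u = G + e + mu inp *: u.
  by rewrite /grad_est; congr (_ + _); rewrite /e /G [RHS]addrC addrA subrK.
have cutE l : cut u l = cut u 0 + dotv l G.
  have := dual_cut_affine M (tau inp) u l 0; rewrite subr0 -/G.
  by move: (cut u l) (cut u 0) => a b <-; rewrite addrC subrK.
have err : dotv e (lam - l') <= grad_err.
  by apply: le_trans (ler_norm _) (dotv_grad_err hu _); exact: Lam_sub_le.
have smooth := dual_smooth A_gt0 ergodic tau_gt0 hu hlb' hr.
have below := dual_cut_le ergodic tau_gt0 hu h2.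
rewrite /prox_obj gE in hprox.
have {}smooth : cut lb' lb' <= cut u 0 + dotv lb' G + ell * sqnorm2 (lb' - u).
  by rewrite -(cutE lb').
have {}below : cut u 0 + dotv (st t).2 G <= cut (st t).2 (st t).2.
  by rewrite -(cutE (st t).2).
rewrite (cutE lam); move: smooth below.
move: (cut u 0) (cut lb' lb') (cut (st t).2 (st t).2) => hc D' D smooth below.
apply: le_trans (agd_step al_gt0 al_lt1 mu_gt0 etaE hell uE smooth below hprox) _.
by rewrite lerD2l ler_pM2l // lerD2l.
Qed.

(** Bounds how far the cut at [0] can drop over [Lam] below its value at [0]. *)
Definition init_gap : R := 2 * B * (rsum / (1 - gamma)).

Lemma Vc_ge0 pi i : is_policy pi -> 0 <= Vc M pi 0 i.
Proof. by move=> hpi; rewrite mxE value_ge0 // => s a; rewrite ltW // reward_gt0. Qed.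

Lemma value_reward_le pi i : is_policy pi ->
  value M pi (reward M i) <= reward_max M i / (1 - gamma).
Proof.
move=> hpi; apply: value_le => // s.
rewrite -[leRHS]mul1r -(policy_sum1 hpi s) mulr_suml; apply: ler_sum => a _.
by rewrite ler_wpM2l ?policy_ge0 // reward_le.
Qed.

Lemma threshold_le i : threshold M 0 i <= reward_max M (lift ord0 i) / (1 - gamma).
Proof.
have [pi hpi /(_ i) h] := hslater.
apply: le_trans (value_reward_le (lift ord0 i) hpi).
by apply: le_trans (le_trans _ h) _; rewrite ?lerDl ?mxE // ltW.
Qed.

Lemma init_gap_ge0 : 0 <= init_gap.
Proof.
apply: mulr_ge0; first exact: diam_ge0.
by rewrite mulr_ge0 ?rsum_ge0 ?invr_ge0 ?ogamma_ge0.
Qed.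

(** The first query point is the starting average [0], so the initial potential is charged to the
    same cut as the first step. This matches the full weight [(1 - alpha)^n] of the first policy in
    the output. *)
Lemma potential1 lam : Lam M xi lam ->
  potential 1 lam <= model (qp 1) lam + init_gap + mu inp / 2 * sqnorm2 lam + grad_err.
Proof.
move=> hlam; apply: le_trans (potential_step 0 hlam) _.
have [ps _ _] := opt_policyP ergodic tau_gt0 Lam0.
have s0 : sqnorm2 (0 : 'rV[R]_m) = 0.
  by rewrite /sqnorm2 /dotv big1 // => i _; rewrite mxE mul0r.
have gap : cut 0 0 <= cut 0 lam + init_gap.
  rewrite -lerBlDl -opprB dual_cut_affine subr0 lerNl /init_gap /rsum.
  rewrite mulr_suml mulr_sumr -sumrN; apply: ler_sum => i _.
  have /andP[l0 l1] := hlam i.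
  have h : - (reward_max M (lift ord0 i) / (1 - gamma)) <= (Vc M (star 0) - threshold M) 0 i.
    rewrite [_ 0 i]mxE [(- threshold M) _ _]mxE lerNl opprB lerBlDr.
    by apply: le_trans (threshold_le i) _; rewrite lerDl Vc_ge0.
  apply: le_trans (ler_wpM2l l0 h); rewrite mulrN lerN2 ler_wpM2r //.
  by rewrite divr_ge0 ?reward_max_ge0 ?ogamma_ge0.
rewrite query_point1 /potential /model /= s0 subr0 mulr0 addr0.
have sl := sqnorm2_ge0 lam; have ge := grad_err_ge0.
have ig0 := init_gap_ge0; move: gap sl ge ig0 mu_gt0 al_gt0 al_lt1.
move: (cut 0 0) (cut 0 lam) init_gap (sqnorm2 lam) grad_err (mu inp) (alpha inp).
move=> d0 d ig sl ge mu al hd hsl hge hig hmu hal hal1.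
have h1 : (1 - al) * d0 <= (1 - al) * (d + ig) by rewrite ler_pM2l ?subr_gt0.
have h2 : 0 <= al * ig by rewrite mulr_ge0 // ltW.
have h3 : 0 <= (1 - al) * ge by rewrite mulr_ge0 // subr_ge0 ltW.
have h4 : 0 <= mu * sl by rewrite mulr_ge0 // ltW.
lra.
Qed.

(** Index [i] stands for step [i + 1] of a run of [n + 1] steps. The first weight has no factor
    [alpha], since it includes the share of the starting point. *)
Definition weight n i : R :=
  if i == 0%N then (1 - alpha inp) ^+ n else alpha inp * (1 - alpha inp) ^+ (n - i).

Lemma weight_ge0 n i : 0 <= weight n i.
Proof.
have h : 0 <= 1 - alpha inp by rewrite subr_ge0 ltW.
by rewrite /weight; case: eqP => _; rewrite ?mulr_ge0 ?exprn_ge0 // ltW.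
Qed.

Lemma weightS n i : (i <= n)%N -> weight n.+1 i = (1 - alpha inp) * weight n i.
Proof.
rewrite /weight; case: eqP => _ le_in; first by rewrite exprS.
by rewrite subSn // exprS mulrCA.
Qed.

Lemma weightSn n : weight n.+1 n.+1 = alpha inp.
Proof. by rewrite /weight /= subnn mulr1. Qed.

Lemma sum_weightS n (F : nat -> R) : \sum_(i < n.+2) weight n.+1 i * F i =
  (1 - alpha inp) * (\sum_(i < n.+1) weight n i * F i) + alpha inp * F n.+1.
Proof.
rewrite big_ord_recr /= weightSn mulr_sumr; congr (_ + _).
by apply: eq_bigr => i _; rewrite weightS ?mulrA // -ltnS.
Qed.

Lemma weight_sum1 n : \sum_(i < n.+1) weight n i = 1.
Proof.
elim: n => [|n IH]; first by rewrite big_ord1 /weight expr0.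
have := sum_weightS n (fun=> 1).
under eq_bigr do rewrite mulr1.
by under [X in _ * X]eq_bigr do rewrite mulr1; move=> ->; rewrite IH; ring.
Qed.

(** The recursion is a convex combination, so the gradient errors do not accumulate, while the
    initial terms decay geometrically. *)
Lemma potential_sum n lam : Lam M xi lam ->
  potential n.+1 lam <= \sum_(i < n.+1) weight n i * model (qp i.+1) lam
    + (1 - alpha inp) ^+ n * (init_gap + mu inp / 2 * sqnorm2 lam) + grad_err.
Proof.
move=> hlam; elim: n => [|n IH].
  rewrite big_ord1 /weight !expr0 !mul1r; apply: le_trans (potential1 hlam) _.
  by rewrite !addrA.
apply: le_trans (potential_step n.+1 hlam) _.
rewrite (sum_weightS n (fun i => model (qp i.+1) lam)) exprS.
have h0 : 0 <= 1 - alpha inp by rewrite subr_ge0 ltW.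
have := ler_wpM2l h0 IH.
move: (potential _ _) (model _ _) (\sum_(i < n.+1) _) (_ + _ * sqnorm2 _) (_ ^+ n) grad_err.
by move=> *; lra.
Qed.

Lemma sum_shift2 n (F : nat -> R) :
  \sum_(2 <= t < n.+2) F t = \sum_(i < n) F i.+2.
Proof. by rewrite !big_add1 big_mkord. Qed.

Lemma out_sum n (F : nat -> R) : (1 - alpha inp) ^+ n * F 1%N +
    \sum_(2 <= t < n.+2) alpha inp * (1 - alpha inp) ^+ (n.+1 - t) * F t =
  \sum_(i < n.+1) weight n i * F i.+1.
Proof.
rewrite big_ord_recl sum_shift2; congr (_ + _).
Qed.

(** * Primal guarantee of the output policy *)

Section Output.
Variables (n : nat) (pit : S -> A -> R).
Hypotheses (hhor : horizon inp = n.+1) (hout : arcpo_output M regpo xi inp pit).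

Lemma value_output f : value M pit f = \sum_(i < n.+1) weight n i * value M (reg (qp i.+1)) f.
Proof.
have [hpit hpitE] := hout.
apply: (value_mixture (w := fun i : 'I_n.+1 => weight n i)
   (pol := fun i : 'I_n.+1 => reg (qp i.+1))) => //.
- by move=> i; exact: weight_ge0.
- exact: weight_sum1.
- by move=> i; have [] := accurate (query_point_Lam i).
move=> s a hden; have := hpitE s _ a; rewrite /out_num /out_den hhor /=.
rewrite (out_sum n (fun t => visitation M (arcpo_policy M regpo xi inp t) s a)).
rewrite (out_sum n (fun t => state_visitation M (arcpo_policy M regpo xi inp t) s)).
exact.
Qed.

(** In order: the decayed initial gap; the gradient error, once from the iteration and once from
    replacing maximizers by returned policies in the constraint values; the same replacement in the
    objective; the entropy bonus. *)
Definition primal_err : R := (1 - alpha inp) ^+ n * init_gap + 2 * grad_err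
  + #|A|%:R * delta inp * reward_max M ord0 / (1 - gamma) ^+ 2
  + tau inp * (#|A|%:R / (1 - gamma)).

(** Weak duality: at a feasible policy the multiplier term and the entropy are both nonnegative. *)
Lemma V0_opt_le_cut lb : Lam M xi lb -> V0_opt M <= cut lb lb.
Proof.
move=> hlb; apply: ge_sup.
  have [pi hpi hV] := hslater; exists (V0 M pi), pi => //; split=> // i.
  by apply: le_trans (hV i); rewrite lerDl ltW.
move=> _ [pi [hpi hf] <-].
have [_ /(_ _ hpi) h _] := opt_policyP ergodic tau_gt0 hlb.
apply: le_trans h; rewrite /lagrangian -addrA lerDl addr_ge0 //.
  apply: sumr_ge0 => i _; rewrite mulr_ge0 //; first by case/andP: (hlb i).
  by rewrite [_ 0 i]mxE [(- threshold M) _ _]mxE subr_ge0.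
by rewrite mulr_ge0 ?(ltW tau_gt0) // entropy_ge0.
Qed.

Lemma model_le u lam : Lam M xi u -> Lam M xi lam ->
  model u lam <= V0 M (reg u) + dotv lam (Vc M (reg u) - threshold M)
    + (#|A|%:R * delta inp * reward_max M ord0 / (1 - gamma) ^+ 2 + grad_err
       + tau inp * (#|A|%:R / (1 - gamma)) + mu inp / 2 * sqnorm2 lam).
Proof.
move=> hu hlam; have [pr ar] := accurate hu.
have [ps _ _] := opt_policyP ergodic tau_gt0 hu.
have h0 : V0 M (star u) - V0 M (reg u) <=
    #|A|%:R * delta inp * reward_max M ord0 / (1 - gamma) ^+ 2.
  apply: le_trans (ler_norm _) _; apply: value_lipschitz => //.
  - by move=> s a; rewrite distrC.
  - by move=> s a; rewrite ger0_norm ?reward_le // ltW // reward_gt0.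
  - exact: reward_max_ge0.
have h1 : dotv lam (Vc M (star u) - threshold M) - dotv lam (Vc M (reg u) - threshold M)
    <= grad_err.
  rewrite -dotvBr opprB addrA subrK.
  have -> : dotv lam (Vc M (star u) - Vc M (reg u)) =
      - dotv (Vc M (reg u) - Vc M (star u)) (lam - 0).
    by rewrite /dotv -sumrN; apply: eq_bigr => i _; rewrite !mxE subr0 -mulNr opprB mulrC.
  apply: le_trans (ler_norm _) _; rewrite normrN; apply: dotv_grad_err => //.
  exact: (Lam_sub_le hlam Lam0).
have h2 := ler_wpM2l (ltW tau_gt0) (entropy_star_le A_gt0 ergodic tau_gt0 hu).
rewrite /model /dual_cut /lagrangian.
move: h0 h1 h2; move: (V0 _ _) (V0 _ _) (dotv _ _) (dotv _ _) (tau inp * entropy _ _).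
move: grad_err (_ / _ ^+ 2) (tau inp * _) (_ * sqnorm2 _) => *.
lra.
Qed.

(** Weak duality bounds the potential from below and [potential_sum] from above. The weights there
    are those of the output, so the averaged Lagrangians are the Lagrangian of [pit]. *)
Lemma primal_gap lam : Lam M xi lam ->
  V0_opt M <= V0 M pit + dotv lam (Vc M pit - threshold M) + mu inp * sqnorm2 lam + primal_err.
Proof.
move=> hlam; have [_ hlb] := arcpo_state_Lam n.+1.
have := potential_sum n hlam; have := V0_opt_le_cut hlb.
have -> : dotv lam (Vc M pit - threshold M) =
    \sum_(i < n.+1) weight n i * dotv lam (Vc M (reg (qp i.+1)) - threshold M).
  under [RHS]eq_bigr do rewrite dotvBr mulrBr /dotv mulr_sumr.
  rewrite sumrB -mulr_suml weight_sum1 mul1r exchange_big dotvBr; congr (_ - _).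
  rewrite /dotv; apply: eq_bigr => j _; rewrite mxE value_output mulr_sumr.
  by apply: eq_bigr => i _; rewrite mxE mulrCA.
rewrite {1}/V0 value_output.
set C := #|A|%:R * delta inp * reward_max M ord0 / (1 - gamma) ^+ 2 + grad_err
       + tau inp * (#|A|%:R / (1 - gamma)) + mu inp / 2 * sqnorm2 lam.
have : \sum_(i < n.+1) weight n i * model (qp i.+1) lam <=
    \sum_(i < n.+1) weight n i * value M (reg (qp i.+1)) (reward M ord0) +
    \sum_(i < n.+1) weight n i * dotv lam (Vc M (reg (qp i.+1)) - threshold M) + C.
  rewrite -[C]mul1r -{1}(weight_sum1 n) mulr_suml -!big_split /=.
  apply: ler_sum => i _; rewrite -!mulrDr ler_wpM2l ?weight_ge0 //.
  by apply: model_le => //; exact: query_point_Lam.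
rewrite /potential /primal_err.
have : 0 <= mu inp / 2 * sqnorm2 (st n.+1).2.
  by rewrite mulr_ge0 ?sqnorm2_ge0 // divr_ge0 // ltW.
have : 0 <= mu inp / 2 * sqnorm2 (lam - (st n.+1).1).
  by rewrite mulr_ge0 ?sqnorm2_ge0 // divr_ge0 // ltW.
(* This half of the quadratic term, from the initial distance, joins the half in the model to give
   [mu * sqnorm2 lam]. *)
have : (1 - alpha inp) ^+ n * (mu inp / 2 * sqnorm2 lam) <= mu inp / 2 * sqnorm2 lam.
  rewrite ler_piMl ?exprn_ile1 ?subr_ge0 ?(ltW al_lt1) ?lerBlDr ?lerDl ?(ltW al_gt0) //.
  by rewrite mulr_ge0 ?sqnorm2_ge0 // divr_ge0 // ltW.
rewrite /C.
move: (V0_opt M) (cut _ _) (sqnorm2 lam) (sqnorm2 (st n.+1).2) (sqnorm2 (lam - _)) init_gap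
  grad_err ((1 - alpha inp) ^+ n) (\sum_(i < n.+1) _) (\sum_(i < n.+1) _)
  (\sum_(i < n.+1) _) (mu inp) (_ / _ ^+ 2) (tau inp * _) => *.
lra.
Qed.

End Output.
End Algorithm.

(** * From the Lagrangian to the constrained problem *)

Section SlaterDuality.
Context (R : realType) (S A : finType) (m : nat) (M : cmdp R S A m).
Variables (xi : R) (pit : S -> A -> R).
Hypotheses (xi_gt0 : 0 < xi) (hslater : slater M xi) (hpit : is_policy pit).

Local Notation B := (Defs.radius M xi).

Definition violation : R := \sum_(i < m) Num.max (threshold M 0 i - Vc M pit 0 i) 0.

Lemma violation_ge0 : 0 <= violation.
Proof. by apply: sumr_ge0 => i _; rewrite le_max lexx orbT. Qed.

Lemma V0_le_opt pi : feasible M pi -> V0 M pi <= V0_opt M.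
Proof.
move=> hpi; apply: ub_le_sup; last by exists pi.
exists (reward_max M ord0 / (1 - discount M)) => _ [pi' [hpi' _] <-].
exact: value_reward_le.
Qed.

(* Mixing [pit] with the Slater policy in the proportion [v / (v + xi)] restores feasibility. *)
Lemma V0_sub_opt_le : V0 M pit - V0_opt M <= B * violation.
Proof.
have [pxi hpxi hV] := hslater; set v := violation.
have v0 : 0 <= v := violation_ge0; have vxi : 0 < v + xi by rewrite ltr_wpDl.
pose th := v / (v + xi).
have th0 : 0 <= th by rewrite divr_ge0 // ltW.
have th1 : th <= 1 by rewrite ler_pdivrMr // mul1r lerDl ltW.
pose w (c : bool) := if c then th else 1 - th.
pose pol (c : bool) := if c then pxi else pit.
have w0 c : 0 <= w c by case: c => //; rewrite subr_ge0.
have w1 : \sum_c w c = 1 by rewrite big_bool /= addrC subrK.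
have hpol c : is_policy (pol c) by case: c.
have [pm hpm mixE] := mixture_policy M w0 w1 hpol.
have {}mixE f : value M pm f = th * value M pxi f + (1 - th) * value M pit f.
  by rewrite mixE big_bool.
have fm : feasible M pm.
  split=> // i; rewrite !mxE mixE.
  have h1 := hV i; rewrite mxE in h1.
  have h2 : threshold M 0 i - v <= value M pit (reward M (lift ord0 i)).
    rewrite lerBlDl -lerBlDr /v /violation (bigD1 i) //= mxE.
    apply: le_trans (_ : _ <= Num.max (threshold M 0 i - value M pit (reward M (lift ord0 i))) 0) _.
      by rewrite le_max lexx.
    by rewrite lerDl sumr_ge0 // => j _; rewrite le_max lexx orbT.
  have h3 := ler_wpM2l th0 h1.
  have h4 : (1 - th) * (threshold M 0 i - v) <= (1 - th) * value M pit (reward M (lift ord0 i)).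
    by rewrite ler_wpM2l // subr_ge0.
  apply: le_trans (lerD h3 h4).
  have : th * (v + xi) = v by rewrite /th divfK // gt_eqF.
  lra.
have h := V0_le_opt fm; rewrite /V0 mixE in h.
have h1 : 0 <= th * value M pxi (reward M ord0).
  by rewrite mulr_ge0 // value_ge0 // => s a; rewrite ltW // reward_gt0.
have h2 : th * value M pit (reward M ord0) <= v / xi * (reward_max M ord0 / (1 - discount M)).
  apply: ler_pM => //; last exact: value_reward_le.
    by rewrite value_ge0 // => s a; rewrite ltW // reward_gt0.
  by rewrite ler_pdivlMr // mulrAC ler_pdivrMr // ler_wpM2l // lerDr.
have -> : B * v = v / xi * (reward_max M ord0 / (1 - discount M)).
  by rewrite /Defs.radius; field; rewrite !gt_eqF ?ogamma_gt0.
rewrite /V0; lra.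
Qed.

(** With multiplier [2B] on violated constraints the penalty is [2B] times the violation, of which
    the objective can recover at most [B] times. What is left is bounded by the errors, and dividing
    by [B] explains the scaling in the hypotheses. *)
Lemma eps_optimal_of_gap (mu err eps : R) : 0 < B -> 0 <= mu ->
  (forall lam, Lam M xi lam -> V0_opt M <=
     V0 M pit + dotv lam (Vc M pit - threshold M) + mu * sqnorm2 lam + err) ->
  err <= eps -> err <= B * (eps / 2) -> 4 * mu * m%:R * B <= eps / 2 ->
  eps_optimal M eps pit.
Proof.
move=> B0 mu0 hgap err1 err2 hmu; split.
  have := hgap 0 (Lam0 M xi_gt0).
  have -> : sqnorm2 (0 : 'rV[R]_m) = 0.
    by rewrite /sqnorm2 /dotv big1 // => i _; rewrite mxE mul0r.
  have -> : dotv 0 (Vc M pit - threshold M) = 0.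
    by rewrite /dotv big1 // => i _; rewrite mxE mul0r.
  by move: err1; lra.
rewrite -/violation.
pose lam : 'rV[R]_m := \row_i (if Vc M pit 0 i < threshold M 0 i then 2 * B else 0).
have B2 : 0 <= 2 * B by rewrite mulr_ge0 ?ltW.
have hlam : Lam M xi lam by move=> i; rewrite mxE; case: ifP; rewrite ?lexx ?B2.
have dotE : dotv lam (Vc M pit - threshold M) = - (2 * B) * violation.
  rewrite /dotv /violation mulr_sumr; apply: eq_bigr => i _.
  rewrite [lam _ _]mxE [(_ - threshold M) _ _]mxE [(- threshold M) _ _]mxE.
  case: ltP => h; last by rewrite max_r ?mulr0 ?mul0r // subr_le0.
  by rewrite max_l ?subr_ge0 ?(ltW h) // mulNr -mulrN opprB.
have sqE : sqnorm2 lam <= 4 * m%:R * B ^+ 2.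
  apply: (@le_trans _ _ (\sum_(i < m) 4 * B ^+ 2)).
    apply: ler_sum => i _; rewrite mxE; case: ifP => _; last by rewrite mul0r mulr_ge0 ?sqr_ge0.
    by rewrite le_eqVlt; apply/orP; left; apply/eqP; ring.
  by rewrite sumr_const card_ord -mulr_natl le_eqVlt; apply/orP; left; apply/eqP; ring.
have h := hgap _ hlam; rewrite dotE in h; have h' := V0_sub_opt_le.
rewrite -(ler_pM2l B0).
have h1 := ler_wpM2l mu0 sqE.
have h2 := ler_wpM2l (ltW B0) hmu.
have : mu * (4 * m%:R * B ^+ 2) = B * (4 * mu * m%:R * B) by ring.
move: h h' h1 h2 err2; move: (V0 _ _) (V0_opt _) violation (sqnorm2 _) B m%:R => *.
lra.
Qed.

End SlaterDuality.

(** * Choice of the inputs *)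

Lemma le_ln1B (R : realType) (x : R) : 0 < x -> ln x <= x - 1.
Proof.
move=> x0; have := @le_ln1Dx R (x - 1).
by rewrite (_ : 1 + (x - 1) = x) ; [apply; lra|ring].
Qed.

Lemma exp1B_le (R : realType) (a X : R) n : 0 < a -> a <= 1 -> X <= a * n%:R ->
  (1 - a) ^+ n <= expR (- X).
Proof.
move=> a0 a1 hX; apply: (@le_trans _ _ (expR (- a) ^+ n)).
  by rewrite lerXn2r ?nnegrE ?subr_ge0 ?expR_ge0 // expR_ge1Dx.
by rewrite -expRM_natl ler_expR mulrN lerN2 mulrC.
Qed.

Lemma ln_le_mul (R : realType) (C g G : R) k : 1 <= C -> 1 <= ln g -> 0 < g ->
  G <= C * g ^+ k -> ln G <= (ln C + k%:R) * ln g.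
Proof.
move=> C1 g1 g0 hG; have C0 : 0 < C by rewrite (lt_le_trans _ C1).
have lC : 0 <= ln C by rewrite ln_ge0.
have hk : 0 <= k%:R * ln g by rewrite mulr_ge0 // (le_trans _ g1).
have lCg : ln C <= ln C * ln g by rewrite ler_peMr.
(* For nonpositive [G] the logarithm takes its default value zero. *)
have [G0|G0] := leP G 0.
  by rewrite ln0 // mulr_ge0 ?addr_ge0 // (le_trans _ g1).
have : ln G <= ln (C * g ^+ k) by rewrite ler_ln ?posrE ?mulr_gt0 ?exprn_gt0.
rewrite lnM ?posrE ?exprn_gt0 // lnXn // -mulr_natl; lra.
Qed.

Section InputChoice.
Context (R : realType).
Variables (N r b : R) (m : nat) (x eps : R).
Hypotheses (N1 : 1 <= N) (r_gt0 : 0 < r) (b_gt0 : 0 < b).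
Hypotheses (x_gt0 : 0 < x) (x_lt1 : x < 1) (eps_gt0 : 0 < eps) (eps_le : eps <= expR (-1)).

Let b1 := Num.min 1 b.
(** The variables are to be the number [N] of actions, the sum [r] of the reward maxima,
    [b = (1 - gamma) * B] and [x = sqrt (1 - gamma)]. The entropy error becomes exactly
    [eps * b1 / 8]; the minimum [b1] serves the bounds by [eps] and by [B * eps / 2] at once. *)
Definition tau_choice : R := x ^+ 2 * eps * b1 / (8 * N).
(** The power [x^6] offsets [B ~ x^-2] times the Lipschitz constant [x^-4] of the values. *)
Definition delta_choice : R := eps * b1 * x ^+ 6 / (8 * N * r * (4 * b + 1)).
(** Keeps [4 * mu * m * B] below [eps / 2]; the successor of [m] covers the case without
    constraints. *)
Definition mu_choice : R := eps * x ^+ 2 / (8 * b * m.+1%:R).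
(** Of the form [2 + 4 * K]: the [2] ensures [alpha <= 1 / 2], and [K <= (2 + 4 * K)^2 / 4] settles
    the smoothness condition. *)
Definition alpha_const : R := 2 + 4 * (128 * N ^+ 2 * m.+1%:R ^+ 2 * r ^+ 2 * b / b1).
Definition alpha_choice : R := eps * x ^+ 5 / alpha_const.
Definition decay_const : R := 1 + 16 * b * r / b1.
Definition rate : R := (x ^+ 7 * eps)^-1.
Definition steps : nat := (Num.truncn (ln (decay_const * rate) / alpha_choice)).+1.
Definition steps_const : R := alpha_const * (ln decay_const + 1) + 2.

Let b1_gt0 : 0 < b1. Proof. by rewrite lt_min ltr01. Qed.
Let N0 : 0 < N. Proof. exact: lt_le_trans N1. Qed.
Let m0 : 0 < m.+1%:R :> R. Proof. by rewrite ltr0n. Qed.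
Let x_le1 k : x ^+ k <= 1. Proof. by rewrite exprn_ile1 ?ltW. Qed.
Let xk_gt0 k : 0 < x ^+ k. Proof. exact: exprn_gt0. Qed.
Let b41 : 0 < 4 * b + 1. Proof. by rewrite addr_gt0 // mulr_gt0. Qed.

Lemma eps_le1 : eps <= 1.
Proof. by apply: le_trans eps_le _; rewrite -[leRHS]expR0 ler_expR; lra. Qed.

Lemma tau_choice_gt0 : 0 < tau_choice.
Proof. by rewrite divr_gt0 ?mulr_gt0 ?b1_gt0. Qed.
Lemma delta_choice_gt0 : 0 < delta_choice.
Proof. by rewrite divr_gt0 ?mulr_gt0 ?b1_gt0. Qed.
Lemma mu_choice_gt0 : 0 < mu_choice.
Proof. by rewrite divr_gt0 ?mulr_gt0. Qed.

Lemma alpha_const_ge2 : 2 <= alpha_const.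
Proof.
rewrite lerDl mulr_ge0 // divr_ge0 ?(ltW b1_gt0) //.
by rewrite !mulr_ge0 ?exprn_ge0 ?(ltW b_gt0) ?(ltW r_gt0) ?(ltW N0).
Qed.

Lemma alpha_const_gt0 : 0 < alpha_const.
Proof. exact: lt_le_trans alpha_const_ge2. Qed.

Lemma alpha_choice_gt0 : 0 < alpha_choice.
Proof. by rewrite divr_gt0 ?mulr_gt0 ?alpha_const_gt0. Qed.

Lemma alpha_choice_le : alpha_choice <= 1 / 2.
Proof.
rewrite ler_pdivrMr ?alpha_const_gt0 //.
have : eps * x ^+ 5 <= 1 by rewrite mulr_ile1 ?eps_le1 ?(ltW eps_gt0) ?(ltW (xk_gt0 5)).
have := alpha_const_ge2; lra.
Qed.

(** The powers balance: [alpha^2 ~ eps^2 x^10] against the smoothness constant [1 / (eps x^8)]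
    leaves [eps x^2], the order of [mu]. *)
Lemma smooth_choice :
  2 * N * m%:R * r ^+ 2 / (tau_choice * (x ^+ 2) ^+ 3) * alpha_choice ^+ 2 <=
  (1 - alpha_choice) * mu_choice / 2.
Proof.
apply: (@le_trans _ _ (mu_choice / 4)); last first.
  have := alpha_choice_le; have := mu_choice_gt0.
  move: mu_choice alpha_choice => mu al mu0 hal.
  have : 0 <= mu * (1 / 2 - al) by rewrite mulr_ge0 ?(ltW mu0) // subr_ge0.
  lra.
pose K := 128 * N ^+ 2 * m.+1%:R ^+ 2 * r ^+ 2 * b / b1.
have K0 : 0 <= K.
  by rewrite divr_ge0 ?(ltW b1_gt0) // !mulr_ge0 ?exprn_ge0 ?(ltW b_gt0) ?(ltW r_gt0) ?(ltW N0).
have cE : alpha_const = 2 + 4 * K by [].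
have -> : 2 * N * m%:R * r ^+ 2 / (tau_choice * (x ^+ 2) ^+ 3) * alpha_choice ^+ 2 =
    mu_choice * (K / alpha_const ^+ 2) * (m%:R / m.+1%:R).
  rewrite /tau_choice /alpha_choice /mu_choice /K; field.
  by rewrite !gt_eqF ?alpha_const_gt0 ?b1_gt0.
rewrite -[leRHS]mulr1; apply: ler_pM.
- by rewrite mulr_ge0 ?(ltW mu_choice_gt0) // divr_ge0 // exprn_ge0 // ltW // alpha_const_gt0.
- by rewrite divr_ge0.
- rewrite ler_pM2l ?mu_choice_gt0 // ler_pdivrMr ?exprn_gt0 ?alpha_const_gt0 // cE.
  have : 0 <= K ^+ 2 by rewrite sqr_ge0.
  move: K0; lra.
by rewrite ler_pdivrMr // mul1r ler_nat.
Qed.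

Lemma mu_choice_le : 4 * mu_choice * m%:R * (b / x ^+ 2) <= eps / 2.
Proof.
have -> : 4 * mu_choice * m%:R * (b / x ^+ 2) = eps / 2 * (m%:R / m.+1%:R).
  by rewrite /mu_choice; field; rewrite !gt_eqF.
by rewrite ler_piMr ?divr_ge0 ?(ltW eps_gt0) // ler_pdivrMr // mul1r ler_nat.
Qed.

Lemma rate_gt0 : 0 < rate.
Proof. by rewrite invr_gt0 mulr_gt0. Qed.

Lemma inv_eps_le_rate k l : (k <= 7 * l)%N -> (eps ^+ l * x ^+ k)^-1 <= rate ^+ l.
Proof.
move=> hk; rewrite /rate exprVn exprMn -exprM lef_pV2 ?posrE ?mulr_gt0 ?exprn_gt0 //.
by rewrite mulrC ler_pM2l ?exprn_gt0 // ler_wiXn2l ?(ltW x_gt0) ?(ltW x_lt1).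
Qed.

(** The threshold [1 / e] for [eps] gives this; additive constants can then be absorbed into
    multiples of [ln rate]. *)
Lemma ln_rate_ge1 : 1 <= ln rate.
Proof.
rewrite -[leLHS]expRK ler_ln ?posrE ?expR_gt0 ?rate_gt0 //.
have := @inv_eps_le_rate 0 1 isT; rewrite !expr1 expr0 mulr1; apply: le_trans.
by rewrite -[1]opprK expRN lef_pV2 ?posrE ?expR_gt0.
Qed.

Lemma decay_const_ge1 : 1 <= decay_const.
Proof.
by rewrite lerDl divr_ge0 ?(ltW b1_gt0) // !mulr_ge0 ?(ltW b_gt0) ?(ltW r_gt0).
Qed.

Let decay_rate_gt0 : 0 < decay_const * rate.
Proof. by rewrite mulr_gt0 ?rate_gt0 ?(lt_le_trans _ decay_const_ge1). Qed.

Lemma ln_decay : ln (decay_const * rate) = ln decay_const + ln rate.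
Proof. by rewrite lnM ?posrE ?rate_gt0 ?(lt_le_trans _ decay_const_ge1). Qed.

(** As [steps * alpha] exceeds [ln (decay_const * rate)], the geometric factor is at most the
    inverse of that product, and [1 / rate = x^7 * eps] beats the [x^-4] of the initial gap. *)
Lemma decay_choice : (1 - alpha_choice) ^+ steps * (2 * b * r / x ^+ 4) <= eps * b1 / 8.
Proof.
have h : (1 - alpha_choice) ^+ steps <= (decay_const * rate)^-1.
  rewrite -[in leRHS](lnK (x := decay_const * rate)) ?posrE // -expRN.
  apply: exp1B_le; first exact: alpha_choice_gt0.
    by apply: le_trans alpha_choice_le _; lra.
  by rewrite [leRHS]mulrC -ler_pdivrMr ?alpha_choice_gt0 // /steps ltW // truncnS_gt.
have q0 : 0 <= 2 * b * r / x ^+ 4.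
  by rewrite divr_ge0 ?exprn_ge0 ?(ltW x_gt0) // !mulr_ge0 ?(ltW b_gt0) ?(ltW r_gt0).
apply: le_trans (ler_wpM2r q0 h) _.
have D0 : 0 < decay_const by exact: lt_le_trans decay_const_ge1.
have -> : (decay_const * rate)^-1 * (2 * b * r / x ^+ 4) =
    eps * b1 / 8 * ((16 * b * r / b1) / decay_const * x ^+ 3).
  by rewrite /rate; field; rewrite !gt_eqF ?b1_gt0 // mulr_gt0.
rewrite ler_piMr ?divr_ge0 ?mulr_ge0 ?(ltW eps_gt0) ?(ltW b1_gt0) //.
rewrite mulr_ile1 ?x_le1 ?(ltW (xk_gt0 3)) //.
  by rewrite divr_ge0 ?(ltW D0) // divr_ge0 ?(ltW b1_gt0) // !mulr_ge0 ?(ltW b_gt0) ?(ltW r_gt0).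
by rewrite ler_pdivrMr // mul1r lerDr.
Qed.

Lemma steps_const_ge0 : 0 <= steps_const.
Proof.
rewrite addr_ge0 // mulr_ge0 ?(ltW alpha_const_gt0) // addr_ge0 // ln_ge0 //.
exact: decay_const_ge1.
Qed.

(** The two successors, from truncation and from the horizon, are paid by the summand [2] of
    [steps_const]. *)
Lemma steps_le : steps.+1%:R <= steps_const * ln rate / (eps * x ^+ 5).
Proof.
have a0 := alpha_choice_gt0; have l1 := ln_rate_ge1.
have lD : 0 <= ln decay_const by rewrite ln_ge0 ?decay_const_ge1.
have X0 : 0 <= ln (decay_const * rate) / alpha_choice.
  by rewrite divr_ge0 ?(ltW a0) // ln_decay; lra.
have := truncn_itv X0 => /andP[h _].
have e0 : 0 < eps * x ^+ 5 by rewrite mulr_gt0.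
have : ln (decay_const * rate) / alpha_choice <=
    alpha_const * (ln decay_const + 1) * ln rate / (eps * x ^+ 5).
  rewrite ln_decay /alpha_choice invf_div mulrA.
  rewrite ler_wpM2r ?invr_ge0 ?(ltW e0) // mulrC -[leRHS]mulrA.
  rewrite ler_wpM2l ?(ltW alpha_const_gt0) //.
  have : ln decay_const <= ln decay_const * ln rate by rewrite ler_peMr.
  lra.
have : 1 <= ln rate / (eps * x ^+ 5).
  rewrite ler_pdivlMr // mul1r (le_trans _ l1) //.
  by rewrite mulr_ile1 ?eps_le1 ?(ltW eps_gt0) ?(ltW (xk_gt0 5)).
have -> : steps_const * ln rate / (eps * x ^+ 5) =
    alpha_const * (ln decay_const + 1) * ln rate / (eps * x ^+ 5)
    + 2 * (ln rate / (eps * x ^+ 5)).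
  by rewrite /steps_const; move: alpha_const (ln decay_const) (ln rate) (_^-1) => *; ring.
rewrite /steps -(addn2 (Num.truncn _)) natrD.
move: (alpha_const * _ * _ / _) (ln rate / _) (ln _ / _) (Num.truncn _)%:R h => *; lra.
Qed.

Lemma error_choice (r0 r1 : R) : 0 <= r0 -> 0 <= r1 -> r0 <= r -> r1 <= r ->
  2 * (2 * (b / x ^+ 2) * (N * delta_choice * r1 / (x ^+ 2) ^+ 2))
  + N * delta_choice * r0 / (x ^+ 2) ^+ 2 + tau_choice * (N / x ^+ 2) <= eps * b1 / 4.
Proof.
move=> r00 r10 h0 h1.
have -> : tau_choice * (N / x ^+ 2) = eps * b1 / 8.
  by rewrite /tau_choice; field; rewrite !gt_eqF.
suff : 2 * (2 * (b / x ^+ 2) * (N * delta_choice * r1 / (x ^+ 2) ^+ 2))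
  + N * delta_choice * r0 / (x ^+ 2) ^+ 2 <= eps * b1 / 8 by lra.
have -> : eps * b1 / 8 = delta_choice * N * r * (4 * b + 1) / x ^+ 6.
  by rewrite /delta_choice; field; rewrite !gt_eqF.
have -> : 2 * (2 * (b / x ^+ 2) * (N * delta_choice * r1 / (x ^+ 2) ^+ 2))
  + N * delta_choice * r0 / (x ^+ 2) ^+ 2 =
  delta_choice * N * (r1 * (4 * b) + r0 * x ^+ 2) / x ^+ 6.
  by field; rewrite !gt_eqF.
rewrite ler_wpM2r ?invr_ge0 ?(ltW (xk_gt0 6)) // -[leRHS]mulrA.
rewrite ler_wpM2l ?(ltW (mulr_gt0 delta_choice_gt0 N0)) // mulrDr mulr1 lerD //.
  by rewrite ler_wpM2r // mulr_ge0 // ltW.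
by apply: le_trans h0; rewrite ler_piMr.
Qed.

Lemma delta_tauE : delta_choice * tau_choice =
  eps ^+ 2 * x ^+ 8 * (b1 ^+ 2 / (64 * N ^+ 2 * r * (4 * b + 1))).
Proof. by rewrite /delta_choice /tau_choice; field; rewrite !gt_eqF. Qed.

End InputChoice.

(** * Query complexity *)

Lemma dist_inhabited (R : realType) (X : finType) (p : X -> R) :
  is_dist p -> exists x : X, true.
Proof.
move=> [_ p1]; apply: contrapT => nX; have := oner_neq0 R.
by rewrite -p1 big1 ?eqxx // => x _; case: nX; exists x.
Qed.

Lemma sqrt_ogamma_lt1 (R : realType) (S A : finType) (m : nat) (M : cmdp R S A m) :
  Num.sqrt (1 - discount M) < 1.
Proof. by rewrite -[ltRHS]sqrtr1 ltr_sqrt // ltrBlDr ltrDl gamma_gt0. Qed.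

Section Constants.
Context (R : realType) (m : nat).
Variables (N xi : R) (rmax : 'I_m.+1 -> R).

Let r := \sum_i rmax i.
Let b := rmax ord0 / xi.
Let D := Num.min 1 b ^+ 2 / (64 * N ^+ 2 * r * (4 * b + 1)).

(** Free of the MDP, so that the final constant can be fixed before it; [D] is the constant factor
    of [delta * tau]. *)
Definition regpo_const : R :=
  1 + 2 * (rmax ord0 + b * Num.sqrt (\sum_(i < m) rmax (lift ord0 i) ^+ 2)) / D.
Definition softq_const : R := 1 + 2 * (r + 2 * b * r + 1) / D.

End Constants.

Section Complexity.
Context (R : realType) (S A : finType) (m k0 : nat) (M : cmdp R S A m).
Variables (rmax : 'I_m.+1 -> R) (xi CM beta eps : R).
Hypotheses (A_gt0 : (0 < #|A|)%N) (xi_gt0 : 0 < xi).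
Hypotheses (rmaxE : forall i, reward_max M i = rmax i) (rmax_gt0 : 0 < rmax ord0).
Hypotheses (hslater : slater M xi) (ergodic : uniformly_ergodic M xi CM beta).
Hypotheses (eps_gt0 : 0 < eps) (eps_le : eps <= expR (-1)).

Local Notation gamma := (discount M).
Local Notation B := (Defs.radius M xi).

Let N : R := #|A|%:R.
Let r := \sum_i rmax i.
Let b := rmax ord0 / xi.
Let Rm := Num.sqrt (\sum_(i < m) rmax (lift ord0 i) ^+ 2).
Let x := Num.sqrt (1 - gamma).
Let al := alpha_choice N r b m x eps.
Let g := rate x eps.

(** With [q = alpha] a query point and the next average differ by a multiple of the proximal
    displacement. The horizon is one more than the decay exponent, since decay starts after the
    first step. *)
Definition input_choice : arcpo_input := ArcpoInput
  (steps N r b m x eps).+1 (al / ((1 - al) * mu_choice b m x eps)) al al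
  (tau_choice N b x eps) (mu_choice b m x eps) (delta_choice N r b x eps).
Local Notation inp := input_choice.

Let N1 : 1 <= N. Proof. by rewrite ler1n. Qed.
Let rmax_ge0 i : 0 <= rmax i. Proof. by rewrite -rmaxE reward_max_ge0. Qed.
Let rmax_le i : rmax i <= r.
Proof. by rewrite /r (bigD1 i) //= lerDl sumr_ge0. Qed.
Let r_gt0 : 0 < r. Proof. exact: lt_le_trans (rmax_le ord0). Qed.
Let b_gt0 : 0 < b. Proof. exact: divr_gt0. Qed.
Let x_gt0 : 0 < x. Proof. by rewrite sqrtr_gt0 ogamma_gt0. Qed.
Let x2E : x ^+ 2 = 1 - gamma. Proof. by rewrite sqr_sqrtr // ogamma_ge0. Qed.
Let x_lt1 : x < 1. Proof. exact: sqrt_ogamma_lt1. Qed.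
Let BE : B = b / x ^+ 2.
Proof. by rewrite /Defs.radius rmaxE x2E /b; field; rewrite !gt_eqF ?ogamma_gt0. Qed.
Let al_gt0 : 0 < al. Proof. exact: alpha_choice_gt0. Qed.
Let al_le : al <= 1 / 2. Proof. exact: alpha_choice_le. Qed.
Let al_lt1 : al < 1. Proof. by apply: le_lt_trans al_le _; lra. Qed.
Let mu_gt0 : 0 < mu inp. Proof. exact: mu_choice_gt0. Qed.
Let tau_gt0 : 0 < tau inp. Proof. exact: tau_choice_gt0. Qed.
Let delta_gt0 : 0 < delta inp. Proof. exact: delta_choice_gt0. Qed.
Let eta_gt0 : 0 < eta inp.
Proof. by rewrite /= divr_gt0 // mulr_gt0 ?subr_gt0. Qed.
Let b1_gt0 : 0 < Num.min 1 b. Proof. by rewrite lt_min ltr01. Qed.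
Let rsum_le : \sum_(i < m) reward_max M (lift ord0 i) <= r.
Proof.
rewrite /r big_ord_recl; under eq_bigr do rewrite rmaxE.
by rewrite lerDr.
Qed.

Lemma input_choice_valid : valid_input inp.
Proof.
by split; split=> //=; rewrite ?al_gt0 -?/al ?(ltW al_gt0) ?(ltW al_lt1).
Qed.

Lemma primal_err_le : primal_err M xi inp (steps N r b m x eps) <= eps * Num.min 1 b / 2.
Proof.
have r1 : 0 <= \sum_(i < m) reward_max M (lift ord0 i).
  by apply: sumr_ge0 => i _; exact: reward_max_ge0.
have h := error_choice N1 r_gt0 b_gt0 x_gt0 x_lt1 eps_gt0
  (ltW rmax_gt0) r1 (rmax_le ord0) rsum_le.
have h2 := decay_choice m N1 r_gt0 b_gt0 x_gt0 x_lt1 eps_gt0 eps_le.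
have h3 : (1 - al) ^+ steps N r b m x eps * init_gap M xi <= eps * Num.min 1 b / 8.
  apply: le_trans h2; rewrite ler_wpM2l ?exprn_ge0 ?subr_ge0 ?(ltW al_lt1) //.
  rewrite /init_gap BE -x2E.
  have -> : 2 * b * r / x ^+ 4 = 2 * (b / x ^+ 2) * (r / x ^+ 2).
    by field; rewrite gt_eqF.
  have q0 : 0 <= 2 * (b / x ^+ 2) by rewrite -BE diam_ge0.
  rewrite ler_wpM2l //.
  by rewrite ler_wpM2r ?invr_ge0 ?exprn_ge0 ?(ltW x_gt0).
have h4 : 0 <= eps * Num.min 1 b by apply: mulr_ge0; exact: ltW.
have := lerD h3 h; rewrite !addrA /primal_err /grad_err BE -x2E rmaxE => h5.
apply: le_trans h5 _; clear h h2 h3 r1; move: (eps * _) h4 => e; lra.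
Qed.

Lemma input_choice_optimal regpo pit : regpo_accurate M regpo xi inp ->
  arcpo_output M regpo xi inp pit -> eps_optimal M eps pit.
Proof.
move=> hacc hout; have [hpit _] := hout.
have hr i : reward_max M (lift ord0 i) <= r by rewrite rmaxE.
have hsmooth : 2 * #|A|%:R * m%:R * r ^+ 2 / (tau inp * (1 - gamma) ^+ 3) *
    alpha inp ^+ 2 <= (1 - alpha inp) * mu inp / 2.
  by rewrite -x2E; exact: smooth_choice.
have hgap := primal_gap A_gt0 xi_gt0 eta_gt0 mu_gt0 al_gt0 al_lt1 erefl ergodic
  tau_gt0 delta_gt0 hslater hacc hr erefl hsmooth erefl hout.
have bB : b <= B.
  rewrite BE ler_pdivlMr ?exprn_gt0 // ler_piMr ?(ltW b_gt0) //.
  by rewrite exprn_ile1 ?ltW.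
have he := primal_err_le.
apply: (eps_optimal_of_gap xi_gt0 hslater hpit _ _ hgap).
- exact: lt_le_trans bB.
- exact: ltW.
- apply: le_trans he _; rewrite -mulrA ler_piMr ?(ltW eps_gt0) //.
  by have : Num.min 1 b <= 1 by [rewrite ge_min lexx]; lra.
- apply: le_trans he _; rewrite mulrAC mulrC ler_wpM2r //.
    by rewrite mulr_ge0 // ltW.
  by apply: le_trans bB; rewrite ge_min lexx orbT.
by rewrite BE; exact: mu_choice_le.
Qed.

Let D := Num.min 1 b ^+ 2 / (64 * N ^+ 2 * r * (4 * b + 1)).
Let D_gt0 : 0 < D.
Proof.
have N0 : 0 < N by exact: lt_le_trans N1.
have b41 : 0 < 4 * b + 1 by rewrite addr_gt0 // mulr_gt0.
apply: divr_gt0; rewrite ?exprn_gt0 // (mulr_gt0 _ b41) // (mulr_gt0 _ r_gt0) //.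
by rewrite mulr_gt0 ?exprn_gt0.
Qed.

Local Notation regpo_const := (regpo_const N xi rmax).
Local Notation softq_const := (softq_const N xi rmax).
Let Rm_ge0 : 0 <= Rm. Proof. exact: sqrtr_ge0. Qed.
Lemma regpo_const_ge1 : 1 <= regpo_const.
Proof.
by rewrite lerDl divr_ge0 ?(ltW D_gt0) // mulr_ge0 // addr_ge0 // mulr_ge0 // ltW.
Qed.
Lemma softq_const_ge1 : 1 <= softq_const.
Proof.
have h : 0 <= r + 2 * b * r + 1.
  by rewrite addr_ge0 // addr_ge0 ?(ltW r_gt0) // mulr_ge0 ?(ltW r_gt0) // mulr_ge0 // ltW.
by rewrite lerDl divr_ge0 ?(ltW D_gt0) // mulr_ge0.
Qed.

Let g1 : 1 <= ln g. Proof. exact: ln_rate_ge1. Qed.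
Let g_gt0 : 0 < g. Proof. exact: rate_gt0. Qed.

(** Both iteration counts take logarithms of such quotients. The total power [eps^-2 x^-12] is below
    the square of the rate because [12 <= 14]. *)
Lemma over_delta_tau_le (z C : R) : 0 <= C -> z <= C / x ^+ 4 ->
  z / (delta inp * tau inp) <= C / D * g ^+ 2.
Proof.
move=> C0 hz; rewrite /= delta_tauE // -/D.
have dt : 0 < eps ^+ 2 * x ^+ 8 * D by rewrite mulr_gt0 // mulr_gt0 ?exprn_gt0.
apply: (@le_trans _ _ (C / D * (eps ^+ 2 * x ^+ 12)^-1)).
  rewrite [leRHS](_ : _ = C / x ^+ 4 / (eps ^+ 2 * x ^+ 8 * D)).
    by rewrite ler_wpM2r // invr_ge0 ltW.
  by field; rewrite !gt_eqF.
have CD0 : 0 <= C / D by exact: divr_ge0 C0 (ltW D_gt0).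
rewrite ler_wpM2l //.
exact: (inv_eps_le_rate x_gt0 x_lt1 eps_gt0 (isT : (12 <= 7 * 2)%N)).
Qed.

(** The denominator [ln (1 / gamma)] is at least [1 - gamma = x^2]; the ceiling and [k0] are
    absorbed because [ln g / x^2 >= 1]. *)
Lemma regpo_cost_le queries lam : regpo_cost M queries xi inp k0 -> Lam M xi lam ->
  (queries (delta inp) lam (tau inp))%:R <=
  (ln regpo_const + 3 + k0%:R) * ln g / x ^+ 2.
Proof.
move=> hcost /hcost; rewrite -(ler_int R) intrD -!pmulrn => h; apply: le_trans h _.
have x20 : 0 < x ^+ 2 by exact: exprn_gt0.
have hln : x ^+ 2 <= ln gamma^-1.
  rewrite lnV ?posrE ?gamma_gt0 // lerNr.
  by apply: le_trans (le_ln1B (gamma_gt0 M)) _; rewrite x2E; lra.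
have hG : 2 * (reward_max M ord0 + B * Rmax M) / ((1 - gamma) * delta inp * tau inp)
    <= regpo_const * g ^+ 2.
  have RmE : Rmax M = Rm by rewrite /Rmax; under eq_bigr do rewrite rmaxE.
  rewrite RmE rmaxE -x2E BE.
  rewrite (_ : _ / _ = 2 * (rmax ord0 + b / x ^+ 2 * Rm) / x ^+ 2 / (delta inp * tau inp)).
    2: by field; rewrite !gt_eqF.
  apply: le_trans (over_delta_tau_le (C := 2 * (rmax ord0 + b * Rm)) _ _) _.
  - by rewrite mulr_ge0 // addr_ge0 // mulr_ge0 // ltW.
  - have -> : 2 * (rmax ord0 + b / x ^+ 2 * Rm) / x ^+ 2 =
        2 * (rmax ord0 * x ^+ 2 + b * Rm) / x ^+ 4 by field; rewrite gt_eqF.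
    rewrite ler_wpM2r ?invr_ge0 ?exprn_ge0 ?(ltW x_gt0) // ler_wpM2l // lerD2r.
    by rewrite ler_piMr ?exprn_ile1 ?(ltW x_gt0) ?(ltW x_lt1).
  by rewrite ler_wpM2r ?exprn_ge0 ?(ltW g_gt0) // lerDr.
have hY := ln_le_mul regpo_const_ge1 g1 g_gt0 hG.
have Y0 : 0 <= (ln regpo_const + 2) * ln g.
  apply: mulr_ge0; last exact: le_trans g1.
  by rewrite addr_ge0 // ln_ge0 // regpo_const_ge1.
have hK : ln (2 * (reward_max M ord0 + B * Rmax M) / ((1 - gamma) * delta inp * tau inp))
    / ln gamma^-1 <= (ln regpo_const + 2) * ln g / x ^+ 2.
  have l0 : 0 < ln gamma^-1 by exact: lt_le_trans hln.
  rewrite ler_pdivrMr //; apply: le_trans hY _.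
  by rewrite mulrAC ler_pdivlMr // ler_wpM2l.
have hceil := ceilB1_lt (ln (2 * (reward_max M ord0 + B * Rmax M) /
  ((1 - gamma) * delta inp * tau inp)) / ln gamma^-1).
rewrite intrB -/(regpo_iterations M xi inp) in hceil.
have hz : 1 <= ln g / x ^+ 2.
  by rewrite ler_pdivlMr // mul1r (le_trans _ g1) // exprn_ile1 // ltW.
have hk : k0%:R <= k0%:R * (ln g / x ^+ 2) by rewrite ler_peMr.
have hc := lt_le_trans hceil hK.
move: hc hk hz; rewrite -!mulrA; move: (ln g / _) (_%:~R) (ln regpo_const) k0%:R.
by move=> z c l k *; lra.
Qed.

(** The [x^5] of the step count and the [x^2] of each call make up the [x^7] of the rate; each count
    brings one logarithm. *)
Lemma total_queries_le regpo queries (c : R) : 0 <= c ->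
  (forall lam, Lam M xi lam ->
     (queries (delta inp) lam (tau inp))%:R <= c * ln g / x ^+ 2) ->
  (total_queries M regpo queries xi inp)%:R <= steps_const N r b m * c * g * ln g ^+ 2.
Proof.
move=> c0 hq; rewrite /total_queries big_add1 big_mkord natr_sum.
have q0 : 0 <= c * ln g / x ^+ 2.
  by rewrite divr_ge0 ?exprn_ge0 ?(ltW x_gt0) // mulr_ge0 // (le_trans _ g1).
apply: (@le_trans _ _ (\sum_(i < (steps N r b m x eps).+1) c * ln g / x ^+ 2)).
  by apply: ler_sum => i _; apply: hq; exact: query_point_Lam.
rewrite sumr_const card_ord -mulr_natl.
apply: le_trans (ler_wpM2r q0 (steps_le m N1 r_gt0 b_gt0 x_gt0 x_lt1 eps_gt0 eps_le)) _.
rewrite -/g le_eqVlt; apply/orP; left; apply/eqP.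
have -> : g = (x ^+ 7 * eps)^-1 by [].
move: (ln _) (steps_const _ _ _ _) => l C.
by field; rewrite !gt_eqF.
Qed.

(** * Soft Q-learning as an instance of RegPO *)

Definition softq_steps : nat := (Num.truncn (ln (softq_const * g ^+ 2) / x ^+ 2)).+1.

Let softq_gt0 : 0 < softq_const * g ^+ 2.
Proof. by rewrite mulr_gt0 ?exprn_gt0 // (lt_le_trans _ softq_const_ge1). Qed.

Lemma softq_steps_le : softq_steps%:R <= (ln softq_const + 3) * ln g / x ^+ 2.
Proof.
have hz : 1 <= ln g / x ^+ 2.
  by rewrite ler_pdivlMr ?exprn_gt0 // mul1r (le_trans _ g1) // exprn_ile1 // ltW.
have h := ln_le_mul softq_const_ge1 g1 g_gt0 (lexx (softq_const * g ^+ 2)).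
have lC : 0 <= ln (softq_const * g ^+ 2).
  rewrite lnM ?posrE ?exprn_gt0 ?(lt_le_trans _ softq_const_ge1) //.
  apply: addr_ge0; first by rewrite ln_ge0 // softq_const_ge1.
  by rewrite lnXn // mulrn_wge0 // (le_trans _ g1).
have X0 : 0 <= ln (softq_const * g ^+ 2) / x ^+ 2.
  by rewrite divr_ge0 ?exprn_ge0 ?(ltW x_gt0).
have /andP[h1 _] := truncn_itv X0.
have h2 : ln (softq_const * g ^+ 2) / x ^+ 2 <= (ln softq_const + 2) * ln g / x ^+ 2.
  by rewrite ler_wpM2r ?invr_ge0 ?exprn_ge0 ?(ltW x_gt0).
rewrite /softq_steps -natr1; have := le_trans h1 h2.
rewrite -!mulrA; move: hz; move: (ln g / _) (_%:R) (ln softq_const) => z t l hz ht.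
lra.
Qed.

(** The iteration error is [gamma^N * c] with [gamma <= exp (- x^2)], and softmax multiplies it by
    [2 / tau]; [softq_steps] makes the product at most [delta]. *)
Lemma soft_qlearning_accurate : regpo_accurate M (soft_qlearning M softq_steps) xi inp.
Proof.
move=> lam hlam; split; first exact: softmax_policy.
have [_ _ [Q [fixQ ->]]] := opt_policyP ergodic tau_gt0 hlam.
(* A priori bound for the fixed point: the objective reward, multipliers up to [2B], and
   [tau * #|A| <= 1], over [1 - gamma]. *)
pose c := (r + 2 * b * r + 1) / x ^+ 4.
have hQ s a : `|Q s a| <= c.
  apply: le_trans (soft_fixpoint_le A_gt0 tau_gt0 fixQ s a) _; rewrite -x2E.
  have wle : wnorm1 M lam <= 2 * B * r.
    apply: le_trans (ler_wpM2l (diam_ge0 M xi_gt0) rsum_le).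
    rewrite mulr_sumr; apply: ler_sum => i _; rewrite ler_wpM2r ?reward_max_ge0 //.
    by have /andP[l0 l1] := hlam i; rewrite ger0_norm.
  have tN : tau inp * #|A|%:R <= 1.
    have -> : tau inp * #|A|%:R = (x ^+ 2 * eps * Num.min 1 b) / 8.
      by rewrite /= /tau_choice -/N; field; rewrite !gt_eqF // (lt_le_trans _ N1).
    have : x ^+ 2 * eps * Num.min 1 b <= 1.
      have e1 : eps <= 1 by exact: eps_le1.
      have m1 : Num.min 1 b <= 1 by rewrite ge_min lexx.
      rewrite mulr_ile1 ?(ltW b1_gt0) //; first by rewrite mulr_ge0 ?exprn_ge0 // ltW.
      by rewrite mulr_ile1 ?exprn_ge0 ?exprn_ile1 ?(ltW x_gt0) ?(ltW x_lt1) ?(ltW eps_gt0).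
    by move=> h; rewrite ler_pdivrMr //; apply: le_trans h _; lra.
  rewrite rmaxE BE in wle *.
  have -> : c = (r + 2 * b * r + 1) / x ^+ 2 / x ^+ 2 by rewrite /c; field; rewrite gt_eqF.
  rewrite ler_wpM2r ?invr_ge0 ?exprn_ge0 ?(ltW x_gt0) // !mulrDl.
  have grow z : 0 <= z -> z <= z / x ^+ 2.
    by move=> z0; rewrite ler_pdivlMr ?exprn_gt0 // ler_piMr // exprn_ile1 ?ltW.
  apply: lerD; last by apply: le_trans tN _; exact: grow.
  apply: lerD; first by apply: le_trans (rmax_le ord0) _; apply: grow; exact: ltW.
  apply: le_trans wle _; rewrite le_eqVlt; apply/orP; left; apply/eqP.
  by field; rewrite gt_eqF.
have c0 : 0 <= c.
  have [s _] := dist_inhabited (init_dist M).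
  by have /card_gt0P[a _] := A_gt0; exact: le_trans (hQ s a).
have hit := soft_iteration_le A_gt0 tau_gt0 softq_steps fixQ hQ.
move=> s a; apply: le_trans (softmax_lipschitz A_gt0 tau_gt0 hit s a) _.
have hg : gamma ^+ softq_steps <= (softq_const * g ^+ 2)^-1.
  rewrite -[in leRHS](lnK (x := softq_const * g ^+ 2)) ?posrE // -expRN.
  have -> : gamma = 1 - x ^+ 2 by rewrite x2E opprB addrC subrK.
  apply: exp1B_le; rewrite ?exprn_gt0 ?exprn_ile1 ?(ltW x_gt0) ?(ltW x_lt1) //.
  by rewrite [leRHS]mulrC -ler_pdivrMr ?exprn_gt0 // /softq_steps ltW // truncnS_gt.
have hC : 2 * c / (delta inp * tau inp) <= softq_const * g ^+ 2.
  have h1 : 0 <= 2 * (r + 2 * b * r + 1).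
    rewrite mulr_ge0 // addr_ge0 // addr_ge0 ?(ltW r_gt0) //.
    by rewrite mulr_ge0 ?(ltW r_gt0) // mulr_ge0 // ltW.
  apply: le_trans (over_delta_tau_le h1 _) _; first by rewrite /c mulrA.
  by rewrite ler_wpM2r ?exprn_ge0 ?(ltW g_gt0) // lerDr.
have dt0 : 0 < delta inp * tau inp by exact: mulr_gt0.
rewrite ler_pdivrMr // in hC; rewrite ler_pdivrMr //.
have h2 : 0 <= (softq_const * g ^+ 2)^-1 by rewrite invr_ge0 ltW.
have c2 : 0 <= 2 * c by rewrite mulr_ge0.
rewrite mulrCA; apply: le_trans (ler_wpM2r c2 hg) _.
by apply: le_trans (ler_wpM2l h2 hC) _; rewrite mulrA mulVf ?mul1r // gt_eqF.
Qed.

Lemma rateE : ((1 - gamma) `^ (7 / 2) * eps)^-1 = g.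
Proof.
rewrite /g /rate; congr (_ * _)^-1.
have u0 : 0 <= 1 - gamma by exact: ogamma_ge0.
rewrite /x -powR12_sqrt // -powR_mulrn ?powR_ge0 // -powRrM; congr (_ `^ _).
by field.
Qed.

End Complexity.

(** * Constants uniform over all MDPs, and the final bound *)

Unset Implicit Arguments.

Theorem corollary1 (R : realType) (m nA k0 : nat) (rmax : 'I_m.+1 -> R)
    (xi CM beta : R) (hxi : 0 < xi) (hCM : 0 < CM) (hbeta : 0 < beta < 1) :
  exists (a eps0 : R) (n : nat), [/\ 0 < a, 0 < eps0 &
  forall (S A : finType) (M : cmdp R S A m),
    #|A| = nA ->
    (forall i, reward_max M i = rmax i) ->
    slater M xi ->
    uniformly_ergodic M xi CM beta ->
  forall eps : R, 0 < eps <= eps0 ->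
  let g := ((1 - discount M) `^ (7 / 2) * eps)^-1 in
  exists inp : arcpo_input (R := R), valid_input inp /\
    (forall (regpo : R -> 'rV[R]_m -> R -> S -> A -> R)
            (queries : R -> 'rV[R]_m -> R -> nat),
       regpo_accurate M regpo xi inp ->
       regpo_cost M queries xi inp k0 ->
       (forall pit, arcpo_output M regpo xi inp pit -> eps_optimal M eps pit) /\
       (total_queries M regpo queries xi inp)%:R <= a * g * ln g ^+ n) /\
    (exists N : nat,
       let regpo := soft_qlearning M N in
       let queries := fun (_ : R) (_ : 'rV[R]_m) (_ : R) => N in
       [/\ regpo_accurate M regpo xi inp,
           forall pit, arcpo_output M regpo xi inp pit -> eps_optimal M eps pit &
           (total_queries M regpo queries xi inp)%:R <= a * g * ln g ^+ n])].
Proof.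
pose r := \sum_i rmax i; pose b := rmax ord0 / xi.
(* One constant serves both an arbitrary RegPO and soft Q-learning. The maxima with zero secure its
   sign before an MDP is given. *)
pose c := Num.max 0 (ln (regpo_const nA%:R xi rmax) + 3 + k0%:R)
  + Num.max 0 (ln (softq_const nA%:R xi rmax) + 3).
pose a := Num.max 1 (steps_const nA%:R r b m * c).
have a1 : 1 <= a by rewrite le_max lexx.
exists a, (expR (-1)), 2%N; split; [exact: lt_le_trans a1|exact: expR_gt0|].
move=> S A M hA hr hslater herg eps /andP[eps0 epsle] g.
(* States and actions exist because probability laws sum to one; positive rewards then give
   [rmax ord0 > 0]. *)
have [s _] := dist_inhabited (init_dist M).
have [pi hpi _] := hslater; have [act _] := dist_inhabited (hpi s).
have A0 : (0 < #|A|)%N by apply/card_gt0P; exists act.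
have r0 : 0 < rmax ord0.
  by rewrite -hr (lt_le_trans _ (reward_le M ord0 s act)) // reward_gt0.
have gE : g = rate (Num.sqrt (1 - discount M)) eps by exact: rateE.
have g0 : 0 <= g by rewrite invr_ge0 mulr_ge0 ?powR_ge0 // ltW.
have x_gt0 : 0 < Num.sqrt (1 - discount M) by rewrite sqrtr_gt0 ogamma_gt0.
have sc0 : 0 <= steps_const nA%:R r b m.
  apply: steps_const_ge0; [by rewrite -hA ler1n| |exact: divr_gt0].
  rewrite (lt_le_trans r0) // /r (bigD1 ord0) //= lerDl sumr_ge0 // => i _.
  by rewrite -hr reward_max_ge0.
have lng0 : 0 <= ln (rate (Num.sqrt (1 - discount M)) eps).
  by apply: le_trans (ln_rate_ge1 x_gt0 (sqrt_ogamma_lt1 M) eps0 epsle).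
have grow (c1 : R) : c1 * ln (rate (Num.sqrt (1 - discount M)) eps)
      / Num.sqrt (1 - discount M) ^+ 2 <=
    Num.max 0 c1 * ln (rate (Num.sqrt (1 - discount M)) eps)
      / Num.sqrt (1 - discount M) ^+ 2.
  by rewrite ler_wpM2r ?invr_ge0 ?sqr_ge0 // ler_wpM2r // le_max lexx orbT.
have bound (c1 : R) (n : nat) : c1 <= c ->
    n%:R <= steps_const nA%:R r b m * c1 * g * ln g ^+ 2 -> n%:R <= a * g * ln g ^+ 2.
  move=> hc hn; apply: le_trans hn _.
  rewrite ler_wpM2r ?sqr_ge0 // ler_wpM2r // (le_trans (ler_wpM2l sc0 hc)) //.
  by rewrite le_max lexx orbT.
exists (input_choice M rmax xi eps); split; first exact: input_choice_valid.
split=> [regpo queries hacc hcost|].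
  split=> [pit hout|].
    exact: (input_choice_optimal A0 hxi hr r0 hslater herg eps0 epsle hacc hout).
  apply: (bound (Num.max 0 (ln (regpo_const nA%:R xi rmax) + 3 + k0%:R))).
    by rewrite lerDl le_max lexx.
  rewrite gE -hA; apply: total_queries_le => //; first by rewrite le_max lexx.
  move=> lam hlam; apply: le_trans (regpo_cost_le A0 hxi hr r0 eps0 epsle hcost hlam) _.
  exact: grow.
exists (softq_steps M rmax xi eps).
have hacc := soft_qlearning_accurate A0 hxi hr r0 herg eps0 epsle.
split=> // [pit hout|].
  exact: (input_choice_optimal A0 hxi hr r0 hslater herg eps0 epsle hacc hout).
apply: (bound (Num.max 0 (ln (softq_const nA%:R xi rmax) + 3))).
  by rewrite lerDr le_max lexx.
rewrite gE -hA; apply: total_queries_le => //; first by rewrite le_max lexx.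
move=> lam hlam; apply: le_trans (softq_steps_le A0 hxi hr r0 eps0 epsle) _.
exact: grow.
Qed.
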